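(* Let $n_x,n_y,n_z$ be pairwise relatively prime positive integers. Then $\mathcal{L}(n_x,n_y,n_z)\subseteq \mathcal{L}(n_x,n_y,n_z+2n_xn_y)$, with equality if $n_z\ge 2n_xn_y-n_y$.
   Context: A Lissajous knot is a knot in $\mathbb{R}^3$ admitting a parameterization $K(t)=(\cos(n_xt+\phi_x),\cos(n_yt+\phi_y),\cos(n_zt+\phi_z))$, $0\le t\le 2\pi$, where the frequencies $n_x,n_y,n_z$ are integers and the phase shifts $\phi_x,\phi_y,\phi_z$ are real numbers (chosen so that the curve is embedded). $\mathcal{L}(n_x,n_y,n_z)$ denotes the set of knot types of all Lissajous knots with frequencies $n_x,n_y,n_z$, where a knot and its mirror image are considered equivalent. *)

(* Defs.v *)
From HB Require Import structures.
From mathcomp Require Import all_boot all_order all_algebra.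
From mathcomp Require Import all_classical all_reals all_analysis.
From mathcomp Require Import Rstruct Rstruct_topology.
Set Implicit Arguments. Unset Strict Implicit. Unset Printing Implicit Defensive.
Import Order.TTheory GRing.Theory Num.Theory.
Local Open Scope classical_set_scope.
Local Open Scope ring_scope.

Definition point := (Rdefinitions.R * Rdefinitions.R * Rdefinitions.R)%type.

Definition lissajous (nx ny nz : nat) (px py pz : Rdefinitions.R)
  (t : Rdefinitions.R) : point :=
  (cos (nx%:R * t + px), cos (ny%:R * t + py), cos (nz%:R * t + pz)).

Definition embedded (K : Rdefinitions.R -> point) : Prop :=
  forall s t, 0 <= s -> s < 2 * pi -> 0 <= t -> t < 2 * pi -> K s = K t -> s = t.

Definition knot_of (K : Rdefinitions.R -> point) : set point :=
  K @` `[0, 2 * pi].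

Definition homeomorphism (h : point -> point) : Prop :=
  exists g : point -> point,
    cancel h g /\ cancel g h /\ continuous h /\ continuous g.

Definition ambient_isotopic (A B : set point) : Prop :=
  exists H : Rdefinitions.R -> point -> point,
    {within `[0, 1] `*` [set: point], continuous (fun p => H p.1 p.2)} /\
    (forall t, 0 <= t <= 1 -> homeomorphism (H t)) /\
    (forall x, H 0 x = x) /\
    H 1 @` A = B.

Definition mirror (p : point) : point := (p.1.1, p.1.2, - p.2).

Definition knot_equiv (A B : set point) : Prop :=
  ambient_isotopic A B \/ ambient_isotopic A (mirror @` B).

(* L(nx,ny,nz): the (equivalence-closed) collection of all knots whose knot
   type is that of some Lissajous knot with frequencies nx ny nz. *)
Definition Lset (nx ny nz : nat) : set (set point) :=
  [set A | exists px py pz : Rdefinitions.R,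
      embedded (lissajous nx ny nz px py pz) /\
      knot_equiv A (knot_of (lissajous nx ny nz px py pz))].

(* Main.v *)
Require Import Defs.
From HB Require Import structures.
From mathcomp Require Import all_boot all_order all_algebra.
From mathcomp Require Import Rstruct Rstruct_topology.
From mathcomp Require Import all_classical all_reals all_analysis.
From mathcomp Require Import ring lra zify.

(** Put [a = ny pz - n py], [b = nx pz - n px], [c = ny px - nx py] for the phases
    of a Lissajous curve with frequencies [nx], [ny], [n]; then
    [nx a - ny b = n c].  After a small perturbation of the phases none of [a],
    [b], [c] is a multiple of [pi].  The double points of the projection to the
    xy-plane are then of two kinds; at one kind the sign of the crossing depends
    only on [floor (b / pi)] modulo [2 nx], at the other only on [floor (a / pi)]
    modulo [2 ny], and both signs depend on [n] only modulo [2 nx ny].  Moving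
    [c] between two consecutive multiples of [pi] does not change the
    combinatorics of the projection.  So two such curves, with frequencies
    congruent modulo [2 nx ny], are isotopic as soon as these floors agree.

    With [a = pi (ma + al)], [b = pi (mb + be)], [c = pi (mc + ga)] and
    [T = nx ma - ny mb - n mc], the relation is [nx al - ny be - n ga = - T],
    which has solutions in the open unit cube iff [- nx < T < n + ny].  Passing
    from [n] to [n + 2 nx ny] only enlarges this range; conversely [T] matters
    only modulo [2 nx ny], and when [n >= 2 nx ny - ny] the range contains all
    residues.

    Isotopies come from paths of curves that stay uniformly bi-Lipschitz: if
    [G - K] is Lipschitz with respect to [K] with constant [k < 1], it extends to
    a [k]-Lipschitz map [E] of the space, and [x + t E x] is an ambient isotopy
    from [K] to [G]. *)

Set Implicit Arguments. Unset Strict Implicit. Unset Printing Implicit Defensive.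
Import Order.TTheory GRing.Theory Num.Theory.
Import numFieldNormedType.Exports.
Local Open Scope classical_set_scope.
Local Open Scope ring_scope.

(** * Lipschitz perturbations of the identity *)

Lemma lipschitz_continuous (R : realType) (V W : normedModType R) (f : V -> W)
  (k : R) : (forall x y, `|f x - f y| <= k * `|x - y|) -> continuous f.
Proof.
move=> fk x; apply/cvgrPdist_le => e e0; near=> y.
apply: le_trans (fk _ _) _.
have k1 : 0 < `|k| + 1 by rewrite ltr_pwDr.
have : `|x - y| <= e / (`|k| + 1).
  near: y; apply: cvgr_dist_le; last by rewrite divr_gt0.
  exact: cvg_id.
rewrite ler_pdivlMr// => h; apply: le_trans h.
rewrite mulrC ler_wpM2l// (le_trans (ler_norm k))// lerDl//.
Unshelve. all: by end_near. Qed.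

(** McShane's formula: take the infimum over [t] of [e t + k * |x - K t|]. The datum [e] lives on
    parameters, not on points; the hypothesis, used both ways, forces it to agree at parameters with
    the same image. *)
Lemma mcshane_extension (R : realType) (V : normedModType R) (T : Type)
    (D : set T) (K : T -> V) (e : T -> R) (k : R) :
  D !=set0 -> 0 <= k ->
  (forall s t, D s -> D t -> e s - e t <= k * `|K s - K t|) ->
  exists E : V -> R, (forall x y, `|E x - E y| <= k * `|x - y|) /\
    (forall t, D t -> E (K t) = e t).
Proof.
move=> [t0 Dt0] k0 eK.
pose A (x : V) : set R := [set e t + k * `|x - K t| | t in D].
have A0 x : A x !=set0 by exists (e t0 + k * `|x - K t0|), t0.
have Alb x : has_lbound (A x).
  exists (e t0 - k * `|x - K t0|) => _ [t Dt <-].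
  have := eK _ _ Dt0 Dt.
  have : k * `|K t0 - K t| <= k * (`|x - K t0| + `|x - K t|).
    by rewrite ler_wpM2l// (distrC x (K t0)) -[K t0 - K t](subrKA x)
               (le_trans (ler_normD _ _)).
  by rewrite mulrDr; lra.
have half x y : inf (A x) - inf (A y) <= k * `|x - y|.
  rewrite lerBlDr -lerBlDl; apply: lb_le_inf; first exact: A0.
  move=> _ [t Dt <-]; rewrite lerBlDl.
  apply: le_trans (_ : e t + k * `|x - K t| <= _).
    by apply: ge_inf => //; exists t.
  rewrite addrCA lerD2l -mulrDr ler_wpM2l//.
  by rewrite -[x - K t](subrKA y) (le_trans (ler_normD _ _)).
exists (fun x => inf (A x)); split => [x y|t Dt].
  by rewrite ler_norml lerNl opprB half andbT distrC half.
apply/eqP; rewrite eq_le; apply/andP; split.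
  by apply: ge_inf => //; exists t => //; rewrite subrr normr0 mulr0 addr0.
apply: lb_le_inf; first exact: A0.
by move=> _ [s Ds <-]; rewrite -lerBlDl eK.
Qed.

(** Distances shrink at most by the factor [1 - k], which gives injectivity and a Lipschitz inverse;
    a preimage of [y] is a fixed point of the contraction sending [x] to [y - E x]. *)
Lemma id_plus_contraction_homeo (R : realType) (V : completeNormedModType R)
    (E : V -> V) (k : R) : 0 <= k -> k < 1 ->
  (forall x y, `|E x - E y| <= k * `|x - y|) ->
  exists g : V -> V, [/\ cancel (fun x => x + E x) g,
    cancel g (fun x => x + E x), continuous (fun x => x + E x) & continuous g].
Proof.
move=> k0 k1 Ek.
have expand x y : (1 - k) * `|x - y| <= `|(x + E x) - (y + E y)|.
  have -> : x + E x - (y + E y) = (x - y) - (E y - E x).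
    by rewrite !opprD !opprK addrACA [in RHS]addrC [E x - E y]addrC addrC.
  have := lerB_dist (x - y) (E y - E x).
  by have := Ek y x; rewrite (distrC y x) mulrBl mul1r; lra.
have surj y : exists x, x + E x = y.
  pose F : {fun [set: V] >-> [set: V]} := totalfun (fun x : V => y - E x).
  have cF : is_contraction F.
    exists (NngNum k0); split => //= -[x z] _ /=.
    have -> : y - E x - (y - E z) = E z - E x.
      by rewrite opprB addrC addrA subrK.
    by rewrite (distrC x z) Ek.
  have [|p _ pE] := banach_fixed_point cF closedT; first by exists 0.
  by exists p; rewrite {1}pE /= subrK.
have [g gK] := choice surj.
exists g; split=> //.
- move=> x; apply/eqP; rewrite -subr_eq0 -normr_le0.
  have := expand (g (x + E x)) x; rewrite gK subrr normr0 => h.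
  by rewrite -(pmulr_rle0 _ (_ : 0 < 1 - k))// subr_gt0.
- apply: (@lipschitz_continuous _ _ _ _ (1 + k)) => x y.
  rewrite opprD addrACA mulrDl mul1r (le_trans (ler_normD _ _))//.
  by rewrite lerD2l.
- apply: (@lipschitz_continuous _ _ _ _ (1 - k)^-1) => x y.
  by rewrite ler_pdivlMl ?subr_gt0// -{2}(gK x) -{2}(gK y).
Qed.

HB.saturate prod.

(** Limits are taken coordinatewise. This makes [R * R * R] complete, as the fixed point argument
    above requires. *)
Lemma prod_complete (R : realType) (T U : completeNormedModType R)
    (F : set_system (T * U)) :
  ProperFilter F -> cauchy F -> cvg F.
Proof.
move=> FF Fc.
have c1 : cauchy (fst @ F).
  move=> A entA; rewrite !near_simpl -near2E near_map2.
  have /Fc : entourage [set xy : (T * U) * (T * U) |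
      A (xy.1.1, xy.2.1) /\ setT (xy.1.2, xy.2.2)].
    exact: (prod_entP entA filterT).
  by apply: filterS => -[x y] [].
have c2 : cauchy (snd @ F).
  move=> A entA; rewrite !near_simpl -near2E near_map2.
  have /Fc : entourage [set xy : (T * U) * (T * U) |
      setT (xy.1.1, xy.2.1) /\ A (xy.1.2, xy.2.2)].
    exact: (prod_entP filterT entA).
  by apply: filterS => -[x y] [].
have Fa : cvg (fst @ F) by exact: cauchy_cvg.
have Fb : cvg (snd @ F) by exact: cauchy_cvg.
apply/cvg_ex; exists (lim (fst @ F), lim (snd @ F)).
have FE : (fst x, snd x) @[x --> F] --> (lim (fst @ F), lim (snd @ F)).
  by apply: cvg_pair; [exact: Fa|exact: Fb].
move=> A /FE FA; apply: (@filterS _ F _ _ A _ FA).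
by case.
Qed.

HB.instance Definition _ (R : realType) (T U : completeNormedModType R) :=
  Uniform_isComplete.Build (T * U)%type (@prod_complete R T U).

(** * Isotopies *)

Lemma continuous_fst (U V : topologicalType) : continuous (@fst U V).
Proof. by move=> x; exact: cvg_fst. Qed.

Lemma continuous_snd (U V : topologicalType) : continuous (@snd U V).
Proof. by move=> x; exact: cvg_snd. Qed.

Section StrongIsotopy.
Variables (R : realType) (V : normedModType R).
Implicit Types (A B C : set V) (f g : V -> V).

Definition is_homeo f : Prop :=
  exists g, cancel f g /\ cancel g f /\ continuous f /\ continuous g.

(* Unlike [ambient_isotopic], continuity is required for all real times, so
   that isotopies compose without any restriction to [0, 1]. *)
Definition strongly_isotopic A B : Prop :=
  exists H : R -> V -> V,
    [/\ continuous (fun p : R * V => H p.1 p.2),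
        forall t, 0 <= t <= 1 -> is_homeo (H t),
        forall x, H 0 x = x & H 1 @` A = B].

Lemma is_homeo_comp f g :
  is_homeo f -> is_homeo g -> is_homeo (g \o f).
Proof.
move=> [f' [fK [f'K [cf cf']]]] [g' [gK [g'K [cg cg']]]].
exists (f' \o g'); split; first exact: can_comp.
split; first exact: can_comp.
split=> x; apply: continuous_comp.
- exact: cf.
- exact: cg.
- exact: cg'.
- exact: cf'.
Qed.

Lemma strongly_isotopic_refl A : strongly_isotopic A A.
Proof.
exists (fun _ x => x); split => //.
- by move=> p; exact: cvg_snd.
- by move=> t _; exists id; do !split => //; move=> x; exact: cvg_id.
- by rewrite image_id.
Qed.

Lemma strongly_isotopic_trans A B C :
  strongly_isotopic A B -> strongly_isotopic B C -> strongly_isotopic A C.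
Proof.
move=> [H [cH hH H0 <-]] [G [cG hG G0 <-]].
exists (fun t => G t \o H t); split.
- move=> p; exact: (cvg_comp2 (@continuous_fst _ _ p) (cH p) (cG (p.1, H p.1 p.2))).
- by move=> t t01; apply: is_homeo_comp; [exact: hH|exact: hG].
- by move=> x /=; rewrite H0 G0.
- by rewrite image_comp.
Qed.

Lemma strongly_isotopic_conj f A B : involutive f -> continuous f ->
  strongly_isotopic A B -> strongly_isotopic (f @` A) (f @` B).
Proof.
move=> fK cf [H [cH hH H0 <-]].
have hf : is_homeo f by exists f.
exists (fun t => f \o H t \o f); split.
- move=> p; apply: cvg_comp; last exact: cf.
  have c2 := cvg_comp _ _ (@continuous_snd _ _ p) (cf _).
  exact: (cvg_comp2 (@continuous_fst _ _ p) c2 (cH (p.1, f p.2))).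
- move=> t t01; apply: is_homeo_comp => //.
  by apply: is_homeo_comp => //; exact: hH.
- by move=> x /=; rewrite H0 fK.
- rewrite !image_comp; apply: eq_imagel => x _ /=.
  by rewrite fK.
Qed.

End StrongIsotopy.

(** Each coordinate of [G - K] is extended separately; the constant remains [k] because the norm is
    the maximum of the coordinates. For times in [0, 1] the map [t *: E] is again [k]-Lipschitz. *)
Lemma perturbation_isotopic (R : realType) (T : Type)
    (D : set T) (K G : T -> R * R * R) (k : R) :
  D !=set0 -> 0 <= k -> k < 1 ->
  (forall s t, D s -> D t ->
     `|(G s - K s) - (G t - K t)| <= k * `|K s - K t|) ->
  strongly_isotopic (K @` D) (G @` D).
Proof.
move=> D0 k0 k1 GK.
have normE (x : (R * R * R)) :
    `|x| = Num.max (Num.max `|x.1.1| `|x.1.2|) `|x.2| by [].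
have ext (f : (R * R * R) -> R) : (forall x, `|f x| <= `|x|) ->
    (forall x y, f (x - y) = f x - f y) ->
    exists E : (R * R * R) -> R, (forall x y, `|E x - E y| <= k * `|x - y|) /\
      (forall t, D t -> E (K t) = f (G t - K t)).
  move=> f1 fB; apply: mcshane_extension => // s t Ds Dt.
  rewrite -fB (le_trans (ler_norm _))// (le_trans (f1 _))//.
  exact: GK.
have [||E1 [E1k E1K]] := ext (fun x => x.1.1).
- by move=> x; rewrite normE !le_max lexx.
- by [].
have [||E2 [E2k E2K]] := ext (fun x => x.1.2).
- by move=> x; rewrite normE !le_max lexx orbT.
- by [].
have [||E3 [E3k E3K]] := ext (fun x => x.2).
- by move=> x; rewrite normE !le_max lexx orbT.
- by [].
pose E x : (R * R * R) := (E1 x, E2 x, E3 x).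
have Ek x y : `|E x - E y| <= k * `|x - y|.
  by rewrite normE !ge_max /= E1k E2k E3k.
exists (fun t x => x + t *: E x); split.
- move=> p; apply: cvgD; first exact: cvg_snd.
  apply: cvgZ; first exact: cvg_fst.
  apply: (@cvg_comp _ _ _ snd E _ _ _ (@continuous_snd _ _ p)).
  exact: lipschitz_continuous Ek _.
- move=> t /andP[t0 t1].
  have [|g [g1 g2 g3 g4]] := @id_plus_contraction_homeo R (R * R * R)%type
      (fun x => t *: E x) k k0 k1.
  + move=> x y; rewrite -scalerBr normrZ ger0_norm//.
    by rewrite (le_trans _ (Ek x y))// ler_piMl.
  + by exists g.
- by move=> x; rewrite scale0r addr0.
- rewrite image_comp; apply: eq_imagel => t Dt /=.
  rewrite scale1r /E E1K// E2K// E3K//.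
  rewrite -[X in K t + X]/((G t - K t)).
  by case: (G t) => -[? ?] ?; case: (K t) => -[? ?] ?; congr (_, _, _);
    rewrite /= addrC subrK.
Qed.

(** [S] is a gauge on pairs of parameters that serves all curves of the family at once. Over a short
    time step the displacement is Lipschitz with constant 1/2 relative to the current curve, so
    finitely many perturbations lead from time 0 to time 1. *)
Lemma family_isotopic (R : realType) (T : Type) (D : set T)
    (K : R -> T -> R * R * R)
    (S : T -> T -> R) (M m : R) :
  D !=set0 -> 0 < m ->
  (forall s t, 0 <= S s t) ->
  (forall u v s t, 0 <= u <= 1 -> 0 <= v <= 1 -> D s -> D t ->
     `|(K v s - K u s) - (K v t - K u t)| <= M * `|v - u| * S s t) ->
  (forall u s t, 0 <= u <= 1 -> D s -> D t -> m * S s t <= `|K u s - K u t|) ->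
  strongly_isotopic (K 0 @` D) (K 1 @` D).
Proof.
move=> D0 m0 S0 KM Km.
(* Enough steps to make [|M| / n] at most half of the lower constant [m]. *)
pose n := (Num.truncn (2 * `|M| / m)).+1.
have nM : `|M| / n%:R <= m / 2.
  have := Num.Theory.truncnS_gt (2 * `|M| / m).
  by rewrite -/n ltr_pdivrMr// ler_pdivrMr ?ltr0n//; lra.
have nn0 : (n%:R : R) != 0 by rewrite pnatr_eq0.
have step i : (i <= n)%N ->
    strongly_isotopic (K 0 @` D) (K (i%:R / n%:R) @` D).
  elim: i => [_|i IH ltin].
    by rewrite mul0r; exact: strongly_isotopic_refl.
  apply: strongly_isotopic_trans (IH (ltnW ltin)) _.
  have b j : (j <= n)%N -> 0 <= (j%:R / n%:R : R) <= 1.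
    by move=> ji; rewrite divr_ge0 //= ler_pdivrMr ?ltr0n// mul1r ler_nat.
  apply: (@perturbation_isotopic _ _ _ _ _ 2^-1) => //; first lra.
  move=> s t Ds Dt.
  apply: le_trans (KM _ _ _ _ (b _ (ltnW ltin)) (b _ ltin) Ds Dt) _.
  have -> : i.+1%:R / n%:R - i%:R / n%:R = n%:R^-1 :> R.
    by rewrite -mulrBl -natr1 addrC addKr mul1r.
  have := Km _ _ _ (b _ (ltnW ltin)) Ds Dt.
  rewrite ger0_norm ?invr_ge0// => h.
  apply: le_trans (_ : m / 2 * S s t <= _); last lra.
  rewrite ler_wpM2r// (le_trans _ nM)// ler_wpM2r ?invr_ge0// ler_norm//.
by have := step n (leqnn n); rewrite divff.
Qed.

(** * Isotopies and the equivalence of knots *)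

Local Notation RR := (Rdefinitions.R : realType).

(** The first isotopy is continuous only within [0, 1]; the second, continuous at all times, can be
    composed with it there. *)
Lemma ambient_strong_trans (A B C : set (RR * RR * RR)) :
  ambient_isotopic A B -> strongly_isotopic B C -> ambient_isotopic A C.
Proof.
move=> [H [cH [hH [H0 <-]]]] [G [cG hG G0 <-]].
exists (fun t => G t \o H t); split; [|split; [|split]].
- move=> p.
  have c1 : {within `[0, 1] `*` [set: Defs.point],
      continuous (fst : RR * Defs.point -> RR)}.
    by apply: continuous_subspaceT; exact: continuous_fst.
  exact: (cvg_comp2 (c1 p) (cH p) (cG (p.1, H p.1 p.2))).
- move=> t t01.
  exact: (@is_homeo_comp RR (RR * RR * RR)%type _ _ (hH t t01) (hG t t01)).
- by move=> x /=; rewrite H0 G0.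
- by rewrite image_comp.
Qed.

Lemma mirrorK : involutive mirror.
Proof. by case=> -[x y] z; rewrite /mirror /= opprK. Qed.

Lemma continuous_mirror : continuous (mirror : RR * RR * RR -> RR * RR * RR).
Proof.
apply: (@lipschitz_continuous RR _ _ _ 1) => x y.
by rewrite mul1r !prod_normE /= -opprD normrN.
Qed.

(** In the mirror case the second isotopy is conjugated by the involution [mirror]. *)
Lemma knot_equiv_strong_trans (A B C : set (RR * RR * RR)) :
  knot_equiv A B -> strongly_isotopic B C -> knot_equiv A C.
Proof.
move=> [AB|AB] BC; [left|right]; first exact: ambient_strong_trans BC.
apply: ambient_strong_trans AB _.
exact: (@strongly_isotopic_conj RR (RR * RR * RR)%type mirror _ _
  mirrorK continuous_mirror BC).
Qed.

(** * Trigonometry *)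

Section Trigonometry.
Variable R : realType.
Implicit Types (x y a b : R) (k : int) (n : nat).

Lemma sin_le_norm x : `|sin x| <= `|x|.
Proof.
wlog x0 : x / 0 <= x.
  move=> h; case: (leP 0 x) => [|/ltW] x0; first exact: h.
  by rewrite -normrN -sinN -(normrN x) h// oppr_ge0.
have [|c _] := @MVT_segment R sin cos 0 x x0.
  by apply: continuous_subspaceT; exact: continuous_sin.
rewrite sin0 !subr0 => ->; rewrite normrM ler_piMl//.
exact: cos_max.
Qed.

Lemma cosB_prod x y : cos x - cos y = - 2 * (sin ((x + y) / 2) * sin ((x - y) / 2)).
Proof.
set p := (_ / 2); set q := (_ / 2).
have -> : x = p + q by rewrite /p /q; field.
have -> : y = p - q by rewrite /p /q; field.
by rewrite cosD cosB; ring.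
Qed.

Lemma sinB_le x y : `|sin x - sin y| <= `|x - y|.
Proof.
have -> : sin x - sin y = 2 * (cos ((x + y) / 2) * sin ((x - y) / 2)).
  set p := (_ / 2); set q := (_ / 2).
  have -> : x = p + q by rewrite /p /q; field.
  have -> : y = p - q by rewrite /p /q; field.
  by rewrite sinD sinB; ring.
have := sin_le_norm ((x - y) / 2).
have := cos_max ((x + y) / 2).
rewrite !normrM normfV (@ger0_norm _ 2)// => c1 s1.
have : `|cos ((x + y) / 2)| * `|sin ((x - y) / 2)| <= 1 * (`|x - y| / 2).
  exact: ler_pM.
lra.
Qed.

Lemma cosB_le x y : `|cos x - cos y| <= `|x - y|.
Proof.
have e z : cos z = sin (z + pi / 2) by rewrite sinDpihalf.
by rewrite !e (le_trans (sinB_le _ _))// opprD addrACA subrr addr0.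
Qed.

Lemma sin_mulrn_le n x : `|sin (n%:R * x)| <= n%:R * `|sin x|.
Proof.
elim: n => [|n IH]; first by rewrite !mul0r sin0 normr0.
rewrite -natr1 !mulrDl !mul1r sinD (le_trans (ler_normD _ _))// lerD//.
  by rewrite normrM (le_trans _ IH)// ler_piMr// cos_max.
by rewrite normrM ler_piMl// cos_max.
Qed.

Lemma sin_addpi k x : exists2 e, e = 1 \/ e = - 1 &
  sin (x + k%:~R * pi) = e * sin x /\ cos (x + k%:~R * pi) = e * cos x.
Proof.
have nat_case m y : exists2 e : R, e = 1 \/ e = - 1 &
    sin (y + m%:R * pi) = e * sin y /\ cos (y + m%:R * pi) = e * cos y.
  elim: m => [|m [e e1 [IHs IHc]]].
    by exists 1; [left|rewrite mul0r addr0 !mul1r].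
  exists (- e).
    by case: e1 => ->; [right|left]; rewrite ?opprK.
  rewrite -natr1 mulrDl mul1r addrA.
  have := sinDpi (y + m%:R * pi); have := cosDpi (y + m%:R * pi).
  by move=> -> ->; rewrite IHs IHc !mulNr.
case: k => m; first exact: nat_case.
(* For negative [k], the natural case is applied at the shifted point, and [e] is its own
   inverse. *)
have [e e1 [es ec]] := nat_case m.+1 (x + (Negz m)%:~R * pi).
have xE : x + (Negz m)%:~R * pi + m.+1%:R * pi = x.
  by rewrite NegzE mulrNz -addrA -mulrDl -pmulrn addNr mul0r addr0.
rewrite xE in es ec.
exists e => //; split.
  by rewrite es; case: e1 => ->; rewrite ?mul1r// !mulN1r opprK.
by rewrite ec; case: e1 => ->; rewrite ?mul1r// !mulN1r opprK.
Qed.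

Lemma sin_intpi k : sin (k%:~R * pi : R) = 0.
Proof.
by have [e _ [+ _]] := sin_addpi k 0; rewrite sin0 mulr0 add0r.
Qed.

Lemma sin_add2pi k x : sin (x + k%:~R * (2 * pi)) = sin x.
Proof.
have [d d1 [ds dc]] := sin_addpi k (0 : R).
have -> : x + k%:~R * (2 * pi) = x + (k%:~R * pi + k%:~R * pi) by ring.
rewrite sinD sinD cosD.
rewrite add0r sin0 cos0 mulr1 mulr0 in ds dc.
by rewrite ds dc; case: d1 => ->; ring.
Qed.

Lemma cos_add2pi k x : cos (x + k%:~R * (2 * pi)) = cos x.
Proof.
have := sin_add2pi k (x + pi / 2).
by rewrite addrAC !sinDpihalf.
Qed.

Lemma sin_eq0P x : sin x = 0 <-> exists k : int, x = k%:~R * pi.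
Proof.
split=> [sx|[k ->]]; last exact: sin_intpi.
pose k := Num.floor (x / pi); exists k.
have pi0 := pi_gt0 R.
have /andP[k1 k2] := floor_itv (x / pi).
set y := x - k%:~R * pi.
have sy : sin y = 0.
  have [e e1 [es _]] := sin_addpi k y.
  have ex : y + k%:~R * pi = x by rewrite /y subrK.
  rewrite ex sx in es; case: e1 es => ->; first by rewrite mul1r.
  by rewrite mulN1r => /esym/eqP; rewrite oppr_eq0 => /eqP.
have y0 : 0 <= y by rewrite subr_ge0 -ler_pdivlMr.
have y1 : y < pi.
  by move: k2; rewrite ltr_pdivrMr// rmorphD /= mulrDl mul1r /y; lra.
apply/eqP; rewrite -subr_eq0 -/y eq_le y0 andbT leNgt.
by apply/negP => y0'; have := @sin_gt0_pi R y; rewrite y0' y1 sy ltxx => /(_ isT).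
Qed.

(** Bezout: from [u * m = v * n + 1], [x] is an integral combination of [m x] and [n x], both
    multiples of [pi]. *)
Lemma sin_coprime_eq0 (m n : nat) x : coprime m n -> (0 < m)%N ->
  sin (m%:R * x) = 0 -> sin (n%:R * x) = 0 -> sin x = 0.
Proof.
move=> cmn m0 /sin_eq0P[k mk] /sin_eq0P[l nl]; apply/sin_eq0P.
have [[|u] v e _] := egcdnP n m0; first by move: e; rewrite mul0n (eqP cmn) addnS.
rewrite (eqP cmn) in e.
exists (u.+1%:Z * k - v%:Z * l).
rewrite rmorphB !rmorphM /= mulrBl -!mulrA -mk -nl -!pmulrn !mulrA -mulrBl.
by rewrite -!natrM e natrD addrC addKr mul1r.
Qed.

(* [dsin n x] is [sin (n x) / sin x], continuously extended to [sin x = 0]. *)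
Fixpoint dsin n x : R :=
  if n is m.+1 then dsin m x * cos x + cos (m%:R * x) else 0.

Lemma dsinE n x : sin (n%:R * x) = dsin n x * sin x.
Proof.
elim: n => [|n IH] /=; first by rewrite !mul0r sin0.
by rewrite -natr1 mulrDl mul1r sinD IH; ring.
Qed.

(** At a zero of the sine the value is [n * cos ((n - 1) * x)], and that cosine is 1 or -1. *)
Lemma dsin_neq0 n x : (0 < n)%N -> sin x = 0 -> dsin n x != 0.
Proof.
case: n => // n _ sx.
have cn m : sin (m%:R * x) = 0 by rewrite dsinE sx mulr0.
have -> : dsin n.+1 x = n.+1%:R * cos (n%:R * x).
  elim: n => [|n IH]; first by rewrite /= !mul0r cos0 mul1r add0r.
  rewrite -[dsin n.+2 x]/(dsin n.+1 x * cos x + cos (n.+1%:R * x)) IH.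
  have -> : cos (n.+1%:R * x) = cos (n%:R * x) * cos x.
    by rewrite -natr1 mulrDl mul1r cosD sx mulr0 subr0.
  by rewrite -!natr1; ring.
rewrite mulf_neq0 ?pnatr_eq0//.
by rewrite -normr_eq0 sin0cos1 ?oner_eq0.
Qed.

Lemma continuous_dsin n : continuous (dsin n).
Proof.
elim: n => [|n IH] x /=; first exact: cvg_cst.
apply: cvgD; first by apply: cvgM; [exact: IH|exact: continuous_cos].
apply: (@cvg_comp _ _ _ (fun y => n%:R * y) cos); last exact: continuous_cos.
by apply: cvgM; [exact: cvg_cst|exact: cvg_id].
Qed.

End Trigonometry.

(** * Families of closed curves *)

Section TameFamilies.
Variable R : realType.
Implicit Types (f g : R -> R -> R) (u v s t : R).

(** Half the distance between the points of the unit circle at angles [s] and [t]; it does not see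
    shifts by [2 * pi], as suits closed curves. *)
Definition chord s t : R := `|sin ((s - t) / 2)|.

Lemma chord_ge0 s t : 0 <= chord s t. Proof. exact: normr_ge0. Qed.

Lemma chord_le1 s t : chord s t <= 1. Proof. exact: sin_max. Qed.

(** The last bound, on mixed differences, is the one that [family_isotopic] asks for; the others
    make the class stable under products. *)
Definition tame_bound f (M : R) : Prop :=
  forall u v s t, 0 <= u <= 1 -> 0 <= v <= 1 ->
  [/\ `|f u s| <= M, `|f v s - f u s| <= M * `|v - u|,
      `|f u s - f u t| <= M * chord s t &
      `|(f v s - f u s) - (f v t - f u t)| <= M * `|v - u| * chord s t].

Definition tame f : Prop :=
  continuous (fun p : R * R => f p.1 p.2) /\ exists M, tame_bound f M.

Lemma tame_bound_ge0 f M : tame_bound f M -> 0 <= M.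
Proof.
by move=> /(_ 0 0 0 0) []; rewrite ?lexx ?ler01// => + _ _ _; exact: le_trans.
Qed.

Lemma tame_bound_le f M N : M <= N -> tame_bound f M -> tame_bound f N.
Proof.
move=> MN fM u v s t u01 v01; have [h1 h2 h3 h4] := fM u v s t u01 v01.
split; first exact: le_trans MN.
- by rewrite (le_trans h2)// ler_wpM2r.
- by rewrite (le_trans h3)// ler_wpM2r// chord_ge0.
- by rewrite (le_trans h4)// !ler_wpM2r// chord_ge0.
Qed.

Lemma tame_affine (p q : R) : tame (fun u _ => p + u * q).
Proof.
split.
  move=> x; apply: cvgD; first exact: cvg_cst.
  by apply: cvgM; [exact: continuous_fst|exact: cvg_cst].
exists (`|p| + `|q|) => u v s t /andP[u0 u1] _; split.
- rewrite (le_trans (ler_normD _ _))// lerD2l normrM ger0_norm//.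
  by rewrite ler_piMl.
- rewrite opprD addrACA subrr add0r -mulrBl normrM mulrC ler_wpM2r//.
  by rewrite lerDr.
- by rewrite subrr normr0 mulr_ge0 ?addr_ge0 ?chord_ge0.
- by rewrite subrr normr0 !mulr_ge0 ?addr_ge0 ?chord_ge0.
Qed.

Lemma tame_cos (n : nat) (p q : R) : tame (fun u t => cos (n%:R * t + (p + u * q))).
Proof.
split.
  move=> x; apply: (@cvg_comp _ _ _ (fun y : R * R => n%:R * y.2 + (p + y.1 * q)) cos);
    last exact: continuous_cos.
  apply: cvgD; first by apply: cvgM; [exact: cvg_cst|exact: continuous_snd].
  apply: cvgD; first exact: cvg_cst.
  by apply: cvgM; [exact: continuous_fst|exact: cvg_cst].
have n0 : 0 <= n%:R :> R by [].
have q0 : 0 <= `|q| by [].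
have nq0 : 0 <= n%:R * `|q| by rewrite mulr_ge0.
(* One summand for each of the four bounds, in their order. *)
exists (1 + `|q| + 2 * n%:R + 2 * (n%:R * `|q|)) => u v s t _ _.
have dE w : cos (n%:R * s + (p + w * q)) - cos (n%:R * t + (p + w * q)) =
    - 2 * (sin (n%:R * ((s + t) / 2) + (p + w * q)) * sin (n%:R * ((s - t) / 2))).
  by rewrite cosB_prod; congr (_ * (sin _ * sin _)); field.
have nt := sin_mulrn_le n ((s - t) / 2); rewrite -/(chord s t) in nt.
have c0 := chord_ge0 s t.
have vu0 : 0 <= `|v - u| by [].
split.
- by rewrite (le_trans (cos_max _))//; lra.
- rewrite (le_trans (cosB_le _ _))//.
  have -> : n%:R * s + (p + v * q) - (n%:R * s + (p + u * q)) = (v - u) * q by ring.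
  by rewrite normrM mulrC ler_wpM2r//; lra.
- rewrite dE normrM normrN (@ger0_norm _ 2)// normrM.
  have : `|sin (n%:R * ((s + t) / 2) + (p + u * q))| * `|sin (n%:R * ((s - t) / 2))|
      <= 1 * (n%:R * chord s t) by apply: ler_pM => //; exact: sin_max.
  move=> h; apply: le_trans (_ : (2 * n%:R) * chord s t <= _); first by lra.
  by rewrite ler_wpM2r//; lra.
- have -> (a b c d : R) : a - b - (c - d) = (a - c) - (b - d) by ring.
  rewrite !dE -mulrBr -mulrBl normrM normrN (@ger0_norm _ 2)// normrM.
  have : `|sin (n%:R * ((s + t) / 2) + (p + v * q)) -
           sin (n%:R * ((s + t) / 2) + (p + u * q))| *
         `|sin (n%:R * ((s - t) / 2))| <= (`|v - u| * `|q|) * (n%:R * chord s t).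
    apply: ler_pM => //; rewrite (le_trans (sinB_le _ _))//.
    by rewrite opprD addrACA subrr add0r opprD addrACA subrr add0r -mulrBl normrM.
  move=> h; apply: le_trans (_ : 2 * (n%:R * `|q|) * `|v - u| * chord s t <= _); first by lra.
  by rewrite !ler_wpM2r//; lra.
Qed.

Lemma tame_add f g : tame f -> tame g -> tame (fun u t => f u t + g u t).
Proof.
move=> [cf [M fM]] [cg [N gN]]; split.
  by move=> x; apply: cvgD; [exact: cf|exact: cg].
exists (M + N) => u v s t u01 v01.
have [f1 f2 f3 f4] := fM u v s t u01 v01.
have [g1 g2 g3 g4] := gN u v s t u01 v01.
split.
- by rewrite (le_trans (ler_normD _ _))// lerD.
- by rewrite opprD addrACA (le_trans (ler_normD _ _))// mulrDl lerD.
- by rewrite opprD addrACA (le_trans (ler_normD _ _))// mulrDl lerD.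
- have -> : f v s + g v s - (f u s + g u s) - (f v t + g v t - (f u t + g u t)) =
    (f v s - f u s - (f v t - f u t)) + (g v s - g u s - (g v t - g u t)) by ring.
  by rewrite (le_trans (ler_normD _ _))// !mulrDl lerD.
Qed.

Lemma tame_mul f g : tame f -> tame g -> tame (fun u t => f u t * g u t).
Proof.
move=> [cf [M fM]] [cg [N gN]]; split.
  by move=> x; apply: cvgM; [exact: cf|exact: cg].
have M0 := tame_bound_ge0 fM; have N0 := tame_bound_ge0 gN.
have MN0 : 0 <= M * N by rewrite mulr_ge0.
exists (4 * (M * N)) => u v s t u01 v01.
have [f1 f2 f3 f4] := fM u v s t u01 v01.
have [fvt _ _ _] := fM v u t s v01 u01.
have [fut f2t _ _] := fM u v t s u01 v01.
have [g1 g2 g3 g4] := gN u v s t u01 v01.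
have [gvs _ g3v _] := gN v u s t v01 u01.
have [gut _ _ _] := gN u v t s u01 v01.
have c0 := chord_ge0 s t.
have d0 : 0 <= `|v - u| by [].
have pM a b (A B : R) : `|a| <= A -> `|b| <= B -> `|a * b| <= A * B.
  by move=> aA bB; rewrite normrM ler_pM.
split.
- by rewrite (le_trans (pM _ _ _ _ f1 g1))//; lra.
- have -> : f v s * g v s - f u s * g u s =
    (f v s - f u s) * g v s + f u s * (g v s - g u s) by ring.
  rewrite (le_trans (ler_normD _ _))//.
  have := pM _ _ _ _ f2 gvs; have := pM _ _ _ _ f1 g2.
  have : 0 <= M * N * `|v - u| by rewrite mulr_ge0.
  by lra.
- have -> : f u s * g u s - f u t * g u t =
    (f u s - f u t) * g u s + f u t * (g u s - g u t) by ring.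
  rewrite (le_trans (ler_normD _ _))//.
  have := pM _ _ _ _ f3 g1; have := pM _ _ _ _ fut g3.
  have : 0 <= M * N * chord s t by rewrite mulr_ge0.
  by lra.
(* Leibniz rule for mixed differences: four products, each at most [M * N * |v - u| * chord s t],
   whence the factor 4. *)
- have -> : f v s * g v s - f u s * g u s - (f v t * g v t - f u t * g u t) =
    (f v s - f u s - (f v t - f u t)) * g v s
    + (f v t - f u t) * (g v s - g v t)
    + (f u s - f u t) * (g v s - g u s)
    + f u t * (g v s - g u s - (g v t - g u t)) by ring.
  rewrite (le_trans (ler_normD _ _))//.
  have n1 := ler_normD ((f v s - f u s - (f v t - f u t)) * g v s
    + (f v t - f u t) * (g v s - g v t)) ((f u s - f u t) * (g v s - g u s)).
  have n2 := ler_normD ((f v s - f u s - (f v t - f u t)) * g v s)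
    ((f v t - f u t) * (g v s - g v t)).
  have := pM _ _ _ _ f4 gvs; have := pM _ _ _ _ fut g4.
  have := pM _ _ _ _ f3 g2; have := pM _ _ _ _ f2t g3v.
  by lra.
Qed.

Definition loop_of (K : R -> R * R * R) : set (R * R * R) := K @` `[0, 2 * pi].

Lemma tame_curve_bound f g (h : R -> R -> R) : tame f -> tame g -> tame h ->
  exists2 M : R, 0 <= M & forall u v s t, 0 <= u <= 1 -> 0 <= v <= 1 ->
    `|((f v s, g v s, h v s) - (f u s, g u s, h u s)) -
      ((f v t, g v t, h v t) - (f u t, g u t, h u t))|
    <= M * `|v - u| * chord s t.
Proof.
move=> [_ [M1 H1]] [_ [M2 H2]] [_ [M3 H3]].
have a1 := tame_bound_ge0 H1; have a2 := tame_bound_ge0 H2.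
have a3 := tame_bound_ge0 H3.
exists (M1 + M2 + M3); first by rewrite !addr_ge0.
move=> u v s t u01 v01.
have M1_le : M1 <= M1 + M2 + M3 by lra.
have [_ _ _ k1] := tame_bound_le M1_le H1 s t u01 v01.
have M2_le : M2 <= M1 + M2 + M3 by lra.
have [_ _ _ k2] := tame_bound_le M2_le H2 s t u01 v01.
have M3_le : M3 <= M1 + M2 + M3 by lra.
have [_ _ _ k3] := tame_bound_le M3_le H3 s t u01 v01.
by rewrite !prod_normE /= !ge_max k1 k2 k3.
Qed.

Lemma domain_neq0 : (`[0, 2 * pi] : set R) !=set0.
Proof. by exists 0; rewrite /= in_itv /= lexx mulr_ge0// pi_ge0. Qed.

Lemma tame_isotopic f g (h : R -> R -> R) (m : R) :
  tame f -> tame g -> tame h -> 0 < m ->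
  (forall u s t, 0 <= u <= 1 -> 0 <= s <= 2 * pi -> 0 <= t <= 2 * pi ->
    m * chord s t <= `|(f u s, g u s, h u s) - (f u t, g u t, h u t)|) ->
  strongly_isotopic (loop_of (fun t => (f 0 t, g 0 t, h 0 t)))
                    (loop_of (fun t => (f 1 t, g 1 t, h 1 t))).
Proof.
move=> tf tg th m0 Km; have [M M0 KM] := tame_curve_bound tf tg th.
apply: (@family_isotopic R R _ (fun u t => (f u t, g u t, h u t)) chord M m) => //.
- exact: domain_neq0.
- exact: chord_ge0.
- by move=> u v s t u01 v01 _ _; exact: KM.
Qed.

(** A lower bound at time 0 alone suffices for short times: up to time [e] the difference of two
    points of the curve drifts by at most [e * M * chord s t], and [e * M] is kept below [m / 2].
    The [M + 1] in the bound on [e] keeps the denominator positive. *)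
Lemma tame_isotopic_near f g (h : R -> R -> R) (m : R) :
  tame f -> tame g -> tame h -> 0 < m ->
  (forall s t, 0 <= s <= 2 * pi -> 0 <= t <= 2 * pi ->
    m * chord s t <= `|(f 0 s, g 0 s, h 0 s) - (f 0 t, g 0 t, h 0 t)|) ->
  exists2 e0 : R, 0 < e0 & forall e, 0 < e -> e <= e0 ->
  strongly_isotopic (loop_of (fun t => (f 0 t, g 0 t, h 0 t)))
                    (loop_of (fun t => (f e t, g e t, h e t))).
Proof.
move=> tf tg th m0 Km; have [M M0 KM] := tame_curve_bound tf tg th.
have M1 : 0 < M + 1 by lra.
exists (Num.min 1 (m / (2 * (M + 1)))).
  by rewrite lt_min ltr01 divr_gt0// mulr_gt0.
move=> e e0; rewrite le_min => /andP[e1 eM].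
have eM' : e * M <= m / 2.
  move: eM; rewrite ler_pdivlMr ?mulr_gt0// => eM.
  by have : e * (2 * M + 2) <= m; [apply: le_trans eM; lra|lra].
have scale u : 0 <= u <= 1 -> 0 <= e * u <= 1.
  by move=> /andP[u0 u1]; rewrite mulr_ge0 ?(ltW e0)//= mulr_ile1// ltW.
rewrite -[X in strongly_isotopic _ (loop_of (fun t => (f X t, g X t, h X t)))]mulr1.
rewrite -[X in strongly_isotopic (loop_of (fun t => (f X t, g X t, h X t)))](mulr0 e).
apply: (@family_isotopic R R _
  (fun u t => (f (e * u) t, g (e * u) t, h (e * u) t)) chord (M * e) (m / 2)).
- exact: domain_neq0.
- lra.
- exact: chord_ge0.
- move=> u v s t u01 v01 _ _.
  rewrite (le_trans (KM _ _ s t (scale _ u01) (scale _ v01)))//.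
  by rewrite -mulrBr normrM (gtr0_norm e0) mulrA.
- move=> u s t u01; rewrite /= !in_itv /= => s01 t01.
  have := Km s t s01 t01.
  have z01 : 0 <= (0 : R) <= 1 by rewrite lexx ler01.
  have := KM _ _ s t z01 (scale _ u01).
  move: (u01) => /andP[u0 u1].
  rewrite subr0 (ger0_norm (mulr_ge0 (ltW e0) u0)).
  set A := (X in `|X|); set B := (X in _ <= `|X|); move=> hA hB.
  have hu : M * (e * u) * chord s t <= m / 2 * chord s t.
    rewrite ler_wpM2r ?chord_ge0// (le_trans _ eM')// mulrCA ler_wpM2l ?(ltW e0)//.
    by rewrite ler_piMr.
  have -> : (f (e * u) s, g (e * u) s, h (e * u) s) -
      (f (e * u) t, g (e * u) t, h (e * u) t) = B + A.
    by rewrite /A /B; congr (_, _, _); rewrite /=; ring.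
  by have := lerB_normD B A; lra.
Qed.

Lemma positive_lower_bound (F : R -> R -> R -> R) :
  continuous (fun p : R * R * R => F p.1.1 p.1.2 p.2) ->
  (forall u s t, 0 <= u <= 1 -> 0 <= s <= 2 * pi -> 0 <= t <= 2 * pi ->
     0 < F u s t) ->
  exists2 m : R, 0 < m & forall u s t, 0 <= u <= 1 -> 0 <= s <= 2 * pi ->
     0 <= t <= 2 * pi -> m <= F u s t.
Proof.
move=> cF F0.
pose A : set (R * R * R) := `[0, 1] `*` `[0, 2 * pi] `*` `[0, 2 * pi].
have cA : compact A by do !apply: compact_setX; exact: segment_compact.
have pi2 : 0 <= 2 * pi :> R by rewrite mulr_ge0// pi_ge0.
have A0 : A !=set0.
  by exists (0, 0, 0); rewrite /A /= !in_itv /= lexx ler01 pi2.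
have [c] := compact_EVT_min A0 cA (continuous_subspaceT cF).
rewrite inE /A /= !in_itv /= => -[[c1 c2] c3] cmin.
exists (F c.1.1 c.1.2 c.2); first exact: F0.
move=> u s t u01 s01 t01; apply: (cmin (u, s, t)).
by rewrite inE /A /= !in_itv /= u01 s01 t01.
Qed.

End TameFamilies.

(** * Lissajous curves *)

Section LissajousCurves.
Variable R : realType.
Implicit Types (s t u sg tau p q a b c px py pz : R) (n nx ny nz : nat) (k l : int).

Definition wave n p t : R := cos (n%:R * t + p).

Definition liss nx ny nz px py pz t : R * R * R :=
  (wave nx px t, wave ny py t, wave nz pz t).

Lemma wave_diff n p sg tau : wave n p (sg + tau) - wave n p (sg - tau) =
  - 2 * (sin (n%:R * sg + p) * sin (n%:R * tau)).
Proof. by rewrite /wave cosB_prod; congr (_ * (sin _ * sin _)); field. Qed.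

Lemma wave_diff_half n p s t : wave n p s - wave n p t =
  - 2 * (sin (n%:R * ((s + t) / 2) + p) * sin (n%:R * ((s - t) / 2))).
Proof. by rewrite /wave cosB_prod; congr (_ * (sin _ * sin _)); field. Qed.

(** Up to the factor -2, the quotient of the difference of [wave n p] by [sin ((s - t) / 2)],
    continued across the zeros of that sine. For [s = t] it is minus the derivative of the wave. *)
Definition ddiff n p s t : R :=
  sin (n%:R * ((s + t) / 2) + p) * dsin n ((s - t) / 2).

Lemma wave_ddiff n p s t :
  wave n p s - wave n p t = - 2 * (ddiff n p s t * sin ((s - t) / 2)).
Proof.
by rewrite wave_diff_half dsinE /ddiff mulrA.
Qed.

Lemma norm_wave_diff n p s t :
  `|wave n p s - wave n p t| = 2 * (`|ddiff n p s t| * chord s t).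
Proof. by rewrite wave_ddiff normrM normrN (@ger0_norm _ 2)// normrM. Qed.

Lemma continuous_ddiff n (p : R -> R) : continuous p ->
  continuous (fun x : R * R * R => ddiff n (p x.1.1) x.1.2 x.2).
Proof.
move=> cp x.
have c1 : (fun y : R * R * R => y.1.1) @ x --> x.1.1.
  exact: (cvg_comp _ _ (@continuous_fst _ _ x) (@continuous_fst _ _ _)).
have c2 : (fun y : R * R * R => y.1.2) @ x --> x.1.2.
  exact: (cvg_comp _ _ (@continuous_fst _ _ x) (@continuous_snd _ _ _)).
have c3 : (fun y : R * R * R => y.2) @ x --> x.2 by exact: continuous_snd.
apply: cvgM.
  apply: (@cvg_comp _ _ _
    (fun y : R * R * R => n%:R * ((y.1.2 + y.2) / 2) + p y.1.1) sin);
    last exact: continuous_sin.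
  apply: cvgD; last by apply: (cvg_comp _ _ c1); exact: cp.
  apply: cvgM; first exact: cvg_cst.
  by apply: cvgM; [exact: cvgD|exact: cvg_cst].
apply: (@cvg_comp _ _ _ (fun y : R * R * R => (y.1.2 - y.2) / 2) (dsin n));
  last exact: continuous_dsin.
by apply: cvgM; [exact: cvgB|exact: cvg_cst].
Qed.

Lemma tame_ext (f g : R -> R -> R) : (forall u t, f u t = g u t) -> tame f -> tame g.
Proof. by move=> fg; rewrite (_ : g = f)//; apply/funext => u; apply/funext => t. Qed.

Lemma tame_cst c : tame (fun _ _ : R => c).
Proof. by apply: tame_ext (tame_affine c 0) => u t; rewrite mulr0 addr0. Qed.

Lemma tame_wave n p : tame (fun _ => wave n p).
Proof. by apply: tame_ext (tame_cos n p 0) => u t; rewrite mulr0 addr0. Qed.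

Lemma wave_periodic n p t k : wave n p (t + k%:~R * (2 * pi)) = wave n p t.
Proof.
rewrite /wave -[RHS](cos_add2pi (n%:Z * k)) rmorphM /=; congr cos.
by rewrite -pmulrn; ring.
Qed.

Definition injective_loop (K : R -> R * R * R) : Prop :=
  forall s t, 0 <= s -> s < 2 * pi -> 0 <= t -> t < 2 * pi -> K s = K t -> s = t.

Lemma injective_loop_chord nx ny nz px py pz :
  injective_loop (liss nx ny nz px py pz) ->
  forall s t, liss nx ny nz px py pz s = liss nx ny nz px py pz t -> chord s t = 0.
Proof.
move=> inj s t st.
have pi2 : 0 < 2 * pi :> R by rewrite mulr_gt0// pi_gt0.
have red (r : R) : exists k : int, 0 <= r + k%:~R * (2 * pi) < 2 * pi.
  exists (- Num.floor (r / (2 * pi))).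
  set j := Num.floor _; have /andP[] := floor_itv (r / (2 * pi)).
  rewrite -/j (ler_pdivlMr _ _ pi2) => j1; rewrite (ltr_pdivrMr _ _ pi2) => j2.
  by move: j1 j2; rewrite rmorphD rmorphN /= mulrDl mulNr; lra.
have [k /andP[s0 s1]] := red s; have [l /andP[t0 t1]] := red t.
have : s + k%:~R * (2 * pi) = t + l%:~R * (2 * pi).
  apply: inj => //; rewrite /liss !wave_periodic.
  exact: st.
move=> e; apply/eqP; rewrite normr_eq0; apply/eqP/sin_eq0P; exists (l - k).
by rewrite rmorphB /=; lra.
Qed.

Lemma chord_injective_loop (K : R -> R * R * R) :
  (forall s t, K s = K t -> chord s t = 0) -> injective_loop K.
Proof.
move=> inj s t s0 s1 t0 t1 /inj/eqP; rewrite normr_eq0 => /eqP st.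
have pi0 := pi_gt0 R.
case: (ltgtP s t) => // h.
  have : 0 < sin ((t - s) / 2) by apply: sin_gt0_pi; lra.
  by rewrite -opprB mulNr sinN st oppr0 ltxx.
have : 0 < sin ((s - t) / 2) by apply: sin_gt0_pi; lra.
by rewrite st ltxx.
Qed.

(** An embedded Lissajous curve is automatically immersed: about a parameter of zero velocity all
    three cosines would be even, and the curve would retrace itself. Hence the divided differences
    have no common zero, and compactness gives the bound. *)
Lemma liss_lower_bound nx ny nz px py pz :
  (0 < nx)%N -> (0 < ny)%N -> (0 < nz)%N ->
  injective_loop (liss nx ny nz px py pz) ->
  exists2 m : R, 0 < m & forall s t, 0 <= s <= 2 * pi -> 0 <= t <= 2 * pi ->
    m * chord s t <= `|liss nx ny nz px py pz s - liss nx ny nz px py pz t|.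
Proof.
move=> nx0 ny0 nz0 /injective_loop_chord inj.
have cc (p : R) : continuous (fun _ : R => p) by move=> x; exact: cvg_cst.
have [||m m0 mle] := @positive_lower_bound R (fun _ s t =>
  `|ddiff nx px s t| + `|ddiff ny py s t| + `|ddiff nz pz s t|).
- move=> x; apply: cvgD; first apply: cvgD.
  + exact: (cvg_norm (@continuous_ddiff nx _ (cc px) x)).
  + exact: (cvg_norm (@continuous_ddiff ny _ (cc py) x)).
  + exact: (cvg_norm (@continuous_ddiff nz _ (cc pz) x)).
- move=> _ s t _ _ _.
  rewrite lt_neqAle !addr_ge0// andbT eq_sym; apply/negP.
  rewrite !paddr_eq0 ?addr_ge0// !normr_eq0 -andbA => /and3P[/eqP dx /eqP dy /eqP dz].
  have stc : chord s t = 0.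
    apply: inj; apply/eqP; rewrite -subr_eq0; apply/eqP.
    by congr (_, _, _); rewrite /= wave_ddiff ?dx ?dy ?dz mul0r mulr0.
  have st0 : sin ((s - t) / 2) = 0 by apply/eqP; rewrite -normr_eq0; apply/eqP.
  have sz n p : (0 < n)%N -> ddiff n p s t = 0 -> sin (n%:R * ((s + t) / 2) + p) = 0.
    move=> n0 /eqP; rewrite mulf_eq0 (negbTE (dsin_neq0 n0 st0)) orbF.
    by move/eqP.
  (* All coordinates being symmetric about [(s + t) / 2], the curve takes the same value one unit
     before and one unit after it, against injectivity since [sin 1] is positive. *)
  have : chord ((s + t) / 2 + 1) ((s + t) / 2 - 1) = 0.
    apply: inj; apply/eqP; rewrite -subr_eq0; apply/eqP.
    by congr (_, _, _); rewrite /= wave_diff sz// mul0r mulr0.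
  rewrite /chord (_ : (_ - _) / 2 = 1); last by field.
  move/eqP; rewrite normr_eq0 => /eqP s1.
  have : 0 < sin (1 : R).
    by apply: sin_gt0_pi; rewrite ltr01 /=; have := pi_ge2 R; lra.
  by rewrite s1 ltxx.
exists (m / 2); first by rewrite divr_gt0.
move=> s t s01 t01; have := mle 0 s t _ s01 t01; rewrite lexx ler01 => /(_ isT) h.
set N := `|_ - _|.
have N1 : `|wave nx px s - wave nx px t| <= N.
  by rewrite /N !prod_normE /= !le_max lexx.
have N2 : `|wave ny py s - wave ny py t| <= N.
  by rewrite /N !prod_normE /= !le_max lexx orbT.
have N3 : `|wave nz pz s - wave nz pz t| <= N.
  by rewrite /N !prod_normE /= !le_max lexx !orbT.
rewrite !norm_wave_diff in N1 N2 N3.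
have : m * chord s t <= (`|ddiff nx px s t| + `|ddiff ny py s t| + `|ddiff nz pz s t|) * chord s t.
  by rewrite ler_wpM2r// chord_ge0.
have : 0 <= N by rewrite /N.
by lra.
Qed.

(** Distinct zeros of the sine are at least [pi] apart; away from a zero, the 1-Lipschitz bound
    keeps the sine from vanishing. *)
Lemma sin_near_neq0 a b : b != 0 ->
  exists2 d : R, 0 < d & forall e, 0 < e -> e < d -> sin (a + e * b) != 0.
Proof.
move=> b0; have nb0 : 0 < `|b| by rewrite normr_gt0.
have [/sin_eq0P[k ->]|sa0] := eqVneq (sin a) 0.
  exists (pi / `|b|); first by rewrite divr_gt0// pi_gt0.
  move=> e e0; rewrite ltr_pdivlMr// => ed.
  rewrite addrC; have [s s1 [-> _]] := sin_addpi k (e * b).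
  rewrite mulf_neq0//; first by case: s1 => ->; rewrite ?oppr_eq0 oner_eq0.
  have sb : 0 < sin (e * `|b|) by apply: sin_gt0_pi; rewrite mulr_gt0.
  move: sb; case: (ltgtP b 0) b0 => // bs _; last by rewrite gtr0_norm// => /lt0r_neq0.
  by rewrite ltr0_norm// mulrN sinN oppr_gt0 => /ltr0_neq0.
exists (`|sin a| / `|b|); first by rewrite divr_gt0// normr_gt0.
move=> e e0; rewrite ltr_pdivlMr// => ed; apply/eqP => s0.
have := sinB_le (a + e * b) a.
rewrite s0 sub0r normrN addrC addKr normrM (gtr0_norm e0).
by rewrite leNgt ed.
Qed.

(** None of the three combinations [a], [b], [c] of the phases, in this order, is a multiple of
    [pi]. *)
Definition generic nx ny nz px py pz : Prop :=
  [/\ sin (ny%:R * pz - nz%:R * py) != 0, sin (nx%:R * pz - nz%:R * px) != 0 &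
      sin (ny%:R * px - nx%:R * py) != 0].

(** The phases move in the direction (0, -1, 1): then [a], [b], [c] change at the positive speeds
    [ny + nz], [nx], [nx], so all three leave the multiples of [pi] at once. *)
Lemma liss_perturb_generic nx ny nz px py pz :
  (0 < nx)%N -> (0 < ny)%N -> (0 < nz)%N ->
  injective_loop (liss nx ny nz px py pz) ->
  exists py' pz', generic nx ny nz px py' pz' /\
    strongly_isotopic (loop_of (liss nx ny nz px py pz))
                      (loop_of (liss nx ny nz px py' pz')).
Proof.
move=> nx0 ny0 nz0 /(liss_lower_bound nx0 ny0 nz0)[m m0 Km].
have lissE e : (fun t => (cos (nx%:R * t + (px + e * 0)),
    cos (ny%:R * t + (py + e * -1)), cos (nz%:R * t + (pz + e * 1)))) =
    liss nx ny nz px (py - e) (pz + e).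
  by apply/funext => t; rewrite /liss /wave mulr0 addr0 mulrN !mulr1.
have liss0 t : (cos (nx%:R * t + (px + 0 * 0)),
    cos (ny%:R * t + (py + 0 * -1)), cos (nz%:R * t + (pz + 0 * 1))) =
    liss nx ny nz px py pz t.
  by rewrite /liss /wave !mul0r !addr0.
have [|e0 e0_gt0 iso] := tame_isotopic_near (tame_cos nx px 0) (tame_cos ny py (-1))
  (tame_cos nz pz 1) m0.
  by move=> s t s01 t01; rewrite !liss0; exact: Km.
have nxR : 0 < nx%:R :> R by rewrite ltr0n.
have nyR : 0 < ny%:R :> R by rewrite ltr0n.
have nzR : 0 < nz%:R :> R by rewrite ltr0n.
have [|d1 d1_gt0 H1] := @sin_near_neq0 (ny%:R * pz - nz%:R * py) (ny%:R + nz%:R).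
  by rewrite lt0r_neq0// addr_gt0.
have [|d2 d2_gt0 H2] := @sin_near_neq0 (nx%:R * pz - nz%:R * px) nx%:R.
  by rewrite lt0r_neq0.
have [|d3 d3_gt0 H3] := @sin_near_neq0 (ny%:R * px - nx%:R * py) nx%:R.
  by rewrite lt0r_neq0.
pose e := Num.min (Num.min e0 d1) (Num.min d2 d3) / 2.
have e_gt0 : 0 < e.
  by rewrite divr_gt0// !lt_min e0_gt0 d1_gt0 d2_gt0 d3_gt0.
have e_lt : e < Num.min (Num.min e0 d1) (Num.min d2 d3) by rewrite /e in e_gt0 *; lra.
move: e_lt; rewrite !lt_min -andbA => /and4P[ee0 ed1 ed2 ed3].
exists (py - e), (pz + e); split; last first.
  by rewrite -lissE; have := iso e e_gt0 (ltW ee0); under [fun t => _]funext do rewrite liss0.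
split.
- by rewrite (_ : _ - _ = ny%:R * pz - nz%:R * py + e * (ny%:R + nz%:R)) ?H1//; ring.
- by rewrite (_ : _ - _ = nx%:R * pz - nz%:R * px + e * nx%:R) ?H2//; ring.
- by rewrite (_ : _ - _ = ny%:R * px - nx%:R * py + e * nx%:R) ?H3//; ring.
Qed.

(** Eliminate [sg] between the two multiples of [pi]. *)
Lemma sin_common_zero (m n : nat) p q sg :
  sin (m%:R * sg + p) = 0 -> sin (n%:R * sg + q) = 0 ->
  sin (n%:R * p - m%:R * q) = 0.
Proof.
move=> /sin_eq0P[k hk] /sin_eq0P[l hl]; apply/sin_eq0P.
exists (n%:Z * k - m%:Z * l).
have -> : p = k%:~R * pi - m%:R * sg by rewrite -hk; ring.
have -> : q = l%:~R * pi - n%:R * sg by rewrite -hl; ring.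
by rewrite rmorphB !rmorphM /= -!pmulrn; ring.
Qed.

(** At a double point each coordinate is either reflected, [sin (n * sg + p) = 0], or shifted by a
    period, [sin (n * tau) = 0]. Of three coordinates two are of the same kind: two reflections
    contradict genericity, two shifts contradict coprimality. *)
Lemma generic_injective nx ny nz px py pz :
  (0 < nx)%N -> (0 < ny)%N -> (0 < nz)%N ->
  coprime nx ny -> coprime ny nz -> coprime nx nz ->
  generic nx ny nz px py pz -> injective_loop (liss nx ny nz px py pz).
Proof.
move=> nx0 ny0 nz0 cxy cyz cxz [/eqP ga /eqP gb /eqP gc].
apply: chord_injective_loop => s t [ex ey ez].
apply/eqP; rewrite normr_eq0; apply/negPn/negP => st0.
have alt n p : wave n p s = wave n p t ->
    sin (n%:R * ((s + t) / 2) + p) = 0 \/ sin (n%:R * ((s - t) / 2)) = 0.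
  move/eqP; rewrite -subr_eq0 wave_diff_half mulf_eq0 oppr_eq0 pnatr_eq0 /= mulf_eq0.
  by move=> /orP[/eqP|/eqP]; [left|right].
have two m n : coprime m n -> (0 < m)%N -> sin (m%:R * ((s - t) / 2)) = 0 ->
    sin (n%:R * ((s - t) / 2)) = 0 -> False.
  by move=> cmn m0 h1 h2; move/eqP: st0; apply; exact: sin_coprime_eq0 h1 h2.
case: (alt _ _ ex) => hx; case: (alt _ _ ey) => hy; case: (alt _ _ ez) => hz.
- by apply: gc; exact: sin_common_zero hx hy.
- by apply: gc; exact: sin_common_zero hx hy.
- by apply: gb; rewrite -[LHS]opprK -sinN opprB (sin_common_zero hx hz) oppr0.
- exact: two cyz ny0 hy hz.
- by apply: ga; rewrite -[LHS]opprK -sinN opprB (sin_common_zero hy hz) oppr0.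
- exact: two cxz nx0 hx hz.
- exact: two cxy nx0 hx hy.
- exact: two cxy nx0 hx hy.
Qed.

End LissajousCurves.

(** * Crossings *)

Section Crossings.
Variable R : realType.
Implicit Types (s t u sg tau p q a b c px py pz : R) (n nx ny nz : nat) (k l : int).
Implicit Types (z : R -> R).

(* The times [sg + tau] and [sg - tau] give a double point of
   [(wave m p, wave n q)] at which the first coordinate is reflected. *)
Definition crossing (m n : nat) p sg tau : Prop :=
  [/\ sin tau != 0, sin (m%:R * sg + p) = 0 & sin (n%:R * tau) = 0].

Definition gap z sg tau : R := z (sg + tau) - z (sg - tau).

(** On the diagonal a common zero would be a point of zero planar velocity, excluded by [c]. Off it,
    [c] excludes that both coordinates are reflected and coprimality that both are shifted, which
    leaves the two mixed cases. *)
Lemma planar_crossing nx ny px py s t :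
  (0 < nx)%N -> (0 < ny)%N -> coprime nx ny -> sin (ny%:R * px - nx%:R * py) != 0 ->
  ddiff nx px s t = 0 -> ddiff ny py s t = 0 ->
  crossing nx ny px ((s + t) / 2) ((s - t) / 2) \/
  crossing ny nx py ((s + t) / 2) ((s - t) / 2).
Proof.
move=> nx0 ny0 cxy /eqP gc /eqP; rewrite mulf_eq0 => dx /eqP; rewrite mulf_eq0 => dy.
have [st0|st0] := eqVneq (sin ((s - t) / 2)) 0.
  exfalso; move: dx dy.
  rewrite (negbTE (dsin_neq0 nx0 st0)) (negbTE (dsin_neq0 ny0 st0)) !orbF.
  by move=> /eqP hx /eqP hy; apply: gc; exact: sin_common_zero hx hy.
case/orP: dx => /eqP hx; case/orP: dy => /eqP hy.
- by exfalso; apply: gc; exact: sin_common_zero hx hy.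
- by left; split => //; rewrite dsinE hy mul0r.
- by right; split => //; rewrite dsinE hx mul0r.
- exfalso; move/eqP: st0; apply.
  by apply: (sin_coprime_eq0 cxy nx0); rewrite dsinE ?hx ?hy mul0r.
Qed.

(** The planar divided differences vanish together only at crossings, where the height gap does not;
    by compactness the sum of the three terms has a positive minimum over times and parameters. *)
Lemma moving_isotopic nx ny (px py : R -> R) (z : R -> R -> R) :
  (0 < nx)%N -> (0 < ny)%N -> coprime nx ny ->
  continuous px -> continuous py ->
  tame (fun u => wave nx (px u)) -> tame (fun u => wave ny (py u)) -> tame z ->
  (forall u, 0 <= u <= 1 -> sin (ny%:R * px u - nx%:R * py u) != 0) ->
  (forall u sg tau, 0 <= u <= 1 ->
     crossing nx ny (px u) sg tau \/ crossing ny nx (py u) sg tau ->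
     gap (z u) sg tau != 0) ->
  strongly_isotopic (loop_of (fun t => (wave nx (px 0) t, wave ny (py 0) t, z 0 t)))
                    (loop_of (fun t => (wave nx (px 1) t, wave ny (py 1) t, z 1 t))).
Proof.
move=> nx0 ny0 cxy cpx cpy tx ty tz gc gz.
have cz : continuous (fun x : R * R * R => z x.1.1 x.1.2 - z x.1.1 x.2).
  move=> x.
  have c1 : (fun y : R * R * R => y.1.1) @ x --> x.1.1.
    exact: (cvg_comp _ _ (@continuous_fst _ _ x) (@continuous_fst _ _ _)).
  have c2 : (fun y : R * R * R => y.1.2) @ x --> x.1.2.
    exact: (cvg_comp _ _ (@continuous_fst _ _ x) (@continuous_snd _ _ _)).
  have c3 : (fun y : R * R * R => y.2) @ x --> x.2 by exact: continuous_snd.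
  apply: cvgB.
    exact: (cvg_comp2 c1 c2 (tz.1 (x.1.1, x.1.2))).
  exact: (cvg_comp2 c1 c3 (tz.1 (x.1.1, x.2))).
have [||m m0 mle] := @positive_lower_bound R (fun u s t =>
  `|ddiff nx (px u) s t| + `|ddiff ny (py u) s t| + `|z u s - z u t|).
- move=> x; apply: cvgD; first apply: cvgD.
  + exact: (cvg_norm (@continuous_ddiff _ nx _ cpx x)).
  + exact: (cvg_norm (@continuous_ddiff _ ny _ cpy x)).
  + exact: (cvg_norm (cz x)).
- move=> u s t u01 _ _.
  rewrite lt_neqAle !addr_ge0// andbT eq_sym; apply/negP.
  rewrite !paddr_eq0 ?addr_ge0// !normr_eq0 -andbA => /and3P[/eqP dx /eqP dy dz].
  have := gz _ _ _ u01 (planar_crossing nx0 ny0 cxy (gc u u01) dx dy).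
  have e1 : (s + t) / 2 + (s - t) / 2 = s by field.
  have e2 : (s + t) / 2 - (s - t) / 2 = t by field.
  by rewrite /gap e1 e2 dz.
apply: (@tame_isotopic _ (fun u => wave nx (px u)) (fun u => wave ny (py u)) z (m / 2)) => //.
  by rewrite divr_gt0.
move=> u s t u01 s01 t01; have h := mle u s t u01 s01 t01.
set N := `|_ - _|.
have N1 : `|wave nx (px u) s - wave nx (px u) t| <= N.
  by rewrite /N !prod_normE /= !le_max lexx.
have N2 : `|wave ny (py u) s - wave ny (py u) t| <= N.
  by rewrite /N !prod_normE /= !le_max lexx orbT.
have N3 : `|z u s - z u t| <= N.
  by rewrite /N !prod_normE /= !le_max lexx !orbT.
rewrite !norm_wave_diff in N1 N2.
have : m * chord s t <= (`|ddiff nx (px u) s t| + `|ddiff ny (py u) s t|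
    + `|z u s - z u t|) * chord s t.
  by rewrite ler_wpM2r// chord_ge0.
(* The height difference enters undivided; [chord s t <= 1] absorbs the factor. *)
have : `|z u s - z u t| * chord s t <= N * 1.
  by apply: ler_pM => //; [exact: chord_ge0|exact: chord_le1].
by lra.
Qed.

(** Interpolate the heights linearly: two gaps of the same sign have no vanishing convex
    combination. *)
Lemma height_isotopic nx ny px py z1 z2 :
  (0 < nx)%N -> (0 < ny)%N -> coprime nx ny ->
  sin (ny%:R * px - nx%:R * py) != 0 ->
  tame (fun _ => z1) -> tame (fun _ => z2) ->
  (forall sg tau, crossing nx ny px sg tau \/ crossing ny nx py sg tau ->
     0 < gap z1 sg tau * gap z2 sg tau) ->
  strongly_isotopic (loop_of (fun t => (wave nx px t, wave ny py t, z1 t)))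
                    (loop_of (fun t => (wave nx px t, wave ny py t, z2 t))).
Proof.
move=> nx0 ny0 cxy gc t1 t2 gz.
pose z u t := (1 + u * -1) * z1 t + (0 + u * 1) * z2 t.
have z0E : z 0 = z1 by apply/funext => t; rewrite /z; ring.
have z1E : z 1 = z2 by apply/funext => t; rewrite /z; ring.
have cc (p : R) : continuous (fun _ : R => p) by move=> x; exact: cvg_cst.
rewrite -z0E -z1E.
apply: (@moving_isotopic nx ny (fun _ => px) (fun _ => py) z) => //.
- exact: tame_wave.
- exact: tame_wave.
- apply: tame_add; apply: tame_mul => //; exact: tame_affine.
- move=> u sg tau /andP[u0 u1] /gz; rewrite /gap /z.
  set x1 := z1 _; set y1 := z1 _; set x2 := z2 _; set y2 := z2 _ => d.
  apply/eqP => e.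
  (* Multiplied by the second gap, this equates a nonnegative number with [- u] times a positive
     square, so [u = 0] and the first gap vanishes. *)
  have e' : (1 - u) * (x1 - y1) = - u * (x2 - y2) by lra.
  have h1 : 0 <= (1 - u) * ((x1 - y1) * (x2 - y2)).
    by rewrite mulr_ge0 ?subr_ge0// ltW.
  have h2 : (1 - u) * ((x1 - y1) * (x2 - y2)) = - u * (x2 - y2) ^+ 2.
    by rewrite mulrA e' -mulrA.
  have x20 : 0 < (x2 - y2) ^+ 2.
    rewrite exprn_even_gt0//=; apply/eqP => x20.
    by move: d; rewrite x20 mulr0 ltxx.
  have u0' : u = 0.
    apply/eqP; rewrite eq_le u0 andbT -(pmulr_lle0 _ x20).
    by move: h1; rewrite h2 mulNr oppr_ge0.
  by move: d; rewrite u0' in e'; rewrite (_ : x1 - y1 = 0) ?mul0r ?ltxx//; lra.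
Qed.

(** The floors of [a / pi] and [b / pi] agree modulo [2 * n], and neither quotient is an integer. *)
Definition same_phase n a b : Prop :=
  exists m i : int, [/\ m%:~R * pi < a, a < (m%:~R + 1) * pi,
    m%:~R * pi < b + i%:~R * (2 * n%:R * pi) &
    b + i%:~R * (2 * n%:R * pi) < (m%:~R + 1) * pi].

(** As a function of [x], [sin ((j * pi + x) / n)] has period [2 * n * pi] and changes sign only at
    multiples of [pi]. *)
Lemma same_phase_sin n a b j : (0 < n)%N -> same_phase n a b ->
  0 < sin ((j%:~R * pi + a) / n%:R) * sin ((j%:~R * pi + b) / n%:R) :> R.
Proof.
move=> n0 [m [i [a1 a2 b1 b2]]].
have nR : 0 < n%:R :> R by rewrite ltr0n.
have nR0 : n%:R != 0 :> R by rewrite lt0r_neq0.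
have pi0 := pi_gt0 R.
(* Subtracting [d * pi] brings the angle between [r * pi / n] and [(r + 1) * pi / n], inside the
   open interval from 0 to [pi]. *)
set d := ((m + j) %/ n%:Z)%Z; set r := ((m + j) %% n%:Z)%Z.
have dr : (m + j)%:~R = d%:~R * n%:R + r%:~R :> R.
  by rewrite {1}(divz_eq (m + j) n%:Z) rmorphD rmorphM /= -pmulrn.
have r0 : 0 <= r%:~R :> R by rewrite ler0z modz_ge0// -lt0n.
have r1 : r%:~R + 1 <= n%:R :> R.
  have : (r < n%:Z) by rewrite ltz_pmod.
  by rewrite -lezD1 -(ler_int R) rmorphD /= -pmulrn.
rewrite rmorphD /= in dr.
have key (x : R) : m%:~R * pi < x -> x < (m%:~R + 1) * pi ->
    0 < sin ((j%:~R * pi + x) / n%:R - d%:~R * pi).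
  move=> x1 x2; apply: sin_gt0_pi.
  have -> : (j%:~R * pi + x) / n%:R - d%:~R * pi =
      (j%:~R * pi + x - d%:~R * n%:R * pi) / n%:R by field.
  have dE : d%:~R * n%:R = m%:~R + j%:~R - r%:~R :> R by rewrite dr; ring.
  rewrite dE ltr_pdivrMr// divr_gt0//=.
    have : (r%:~R + 1) * pi <= n%:R * pi :> R by rewrite ler_wpM2r// ltW.
    by lra.
  have : 0 <= r%:~R * pi :> R by rewrite mulr_ge0// ltW.
  by lra.
have ka := key _ a1 a2; have kb := key _ b1 b2.
have bE : (j%:~R * pi + (b + i%:~R * (2 * n%:R * pi))) / n%:R - d%:~R * pi =
  ((j%:~R * pi + b) / n%:R - d%:~R * pi) + i%:~R * (2 * pi) by field.
rewrite bE sin_add2pi in kb.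
have [g g1 [g0 gc]] := sin_addpi d (0 : R).
rewrite add0r sin0 cos0 mulr0 mulr1 in g0 gc.
have sE (x : R) : sin x = g * sin (x - d%:~R * pi).
  by rewrite sinB g0 gc mulr0 subr0 mulrC -mulrA; case: g1 => ->; ring.
rewrite (sE (_ / _)) [X in _ * X](sE (_ / _)) mulrACA.
have -> : g * g = 1 by case: g1 => ->; ring.
by rewrite mul1r mulr_gt0.
Qed.

(** Substitute [sg = (k * pi - p) / m]: the phases enter the gap only through [m * q - n * p], which
    is [b] or [a] according to the kind of crossing. *)
Lemma wave_gap_crossing (m n : nat) p q sg tau k : (0 < m)%N ->
  m%:R * sg + p = k%:~R * pi ->
  gap (wave n q) sg tau = - 2 *
    (sin (((n%:Z * k)%:~R * pi + (m%:R * q - n%:R * p)) / m%:R) * sin (n%:R * tau)).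
Proof.
move=> m0 h; have mR0 : m%:R != 0 :> R by rewrite pnatr_eq0 -lt0n.
rewrite /gap wave_diff; congr (_ * (sin _ * _)).
rewrite rmorphM /= -pmulrn -mulrA -h; field.
exact: mR0.
Qed.

(* The first weight vanishes at the crossings where the second coordinate is
   reflected and the second weight at the others, so that the signs at the two
   kinds of crossings can be prescribed independently, through [b] and [a]. *)
Definition mixed nx ny n px py a b t : R :=
  sin ((nx * ny)%:R * t + nx%:R * py) ^+ 2 * wave n ((b + n%:R * px) / nx%:R) t +
  sin ((nx * ny)%:R * t + ny%:R * px) ^+ 2 * wave n ((a + n%:R * py) / ny%:R) t.

(** Exchanges the two kinds of crossings, so that only the first kind needs a computation. *)
Lemma mixedC nx ny n px py a b : mixed nx ny n px py a b = mixed ny nx n py px b a.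
Proof. by apply/funext => t; rewrite /mixed addrC mulnC. Qed.

Lemma sin2_addpi k (x : R) : sin (x + k%:~R * pi) ^+ 2 = sin x ^+ 2 :> R.
Proof.
have [e e1 [-> _]] := sin_addpi k x.
by rewrite exprMn; case: e1 => ->; rewrite ?sqrrN expr1n mul1r.
Qed.

(** At both times of the crossing the second weight is 0 and the first is the squared sine of [c],
    so the gap is that of a single wave times a positive constant when [c] is generic. *)
Lemma mixed_gap_crossing nx ny n px py a b sg tau k : (0 < nx)%N ->
  nx%:R * sg + px = k%:~R * pi -> sin (ny%:R * tau) = 0 ->
  gap (mixed nx ny n px py a b) sg tau = sin (ny%:R * px - nx%:R * py) ^+ 2 * (- 2 *
    (sin (((n%:Z * k)%:~R * pi + b) / nx%:R) * sin (n%:R * tau))).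
Proof.
move=> nx0 h /sin_eq0P[l hl]; have nR0 : nx%:R != 0 :> R by rewrite pnatr_eq0 -lt0n.
have W := wave_gap_crossing n ((b + n%:R * px) / nx%:R) tau nx0 h.
(* The phase of the first wave in [mixed] was chosen to make this combination equal to [b]. *)
have bE : nx%:R * ((b + n%:R * px) / nx%:R) - n%:R * px = b by field; exact: nR0.
rewrite bE in W; rewrite -W.
have w1 (e : int) : sin ((nx * ny)%:R * (sg + e%:~R * tau) + nx%:R * py) ^+ 2 =
    sin (ny%:R * px - nx%:R * py) ^+ 2 :> R.
  have -> : (nx * ny)%:R * (sg + e%:~R * tau) + nx%:R * py =
      - (ny%:R * px - nx%:R * py) + (ny%:Z * k + nx%:Z * e * l)%:~R * pi.
    have pxE : px = k%:~R * pi - nx%:R * sg by rewrite -h; ring.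
    rewrite natrM rmorphD !rmorphM /= -!pmulrn mulrDl -!mulrA -hl pxE; ring.
  by rewrite sin2_addpi sinN sqrrN.
have w2 (e : int) : sin ((nx * ny)%:R * (sg + e%:~R * tau) + ny%:R * px) = 0 :> R.
  have -> : (nx * ny)%:R * (sg + e%:~R * tau) + ny%:R * px =
      (ny%:Z * k + nx%:Z * e * l)%:~R * pi.
    have pxE : px = k%:~R * pi - nx%:R * sg by rewrite -h; ring.
    rewrite natrM rmorphD !rmorphM /= -!pmulrn mulrDl -!mulrA -hl pxE; ring.
  exact: sin_intpi.
have := w1 1; have := w1 (-1); have := w2 1; have := w2 (-1).
rewrite !mulN1r !mul1r => h1 h2 h3 h4.
by rewrite /gap /mixed h1 h2 h3 h4; ring.
Qed.

End Crossings.

(** * Change of frequency *)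

Section FrequencyShift.
Variable R : realType.
Implicit Types (s t u sg tau p q a b c px py pz : R) (n nx ny nz : nat) (k l : int).

Lemma tame_sin2 n p q : tame (fun u t => sin (n%:R * t + (p + u * q)) ^+ 2).
Proof.
apply: tame_ext (tame_add (tame_cst 1) (tame_mul (tame_cst (-1))
  (tame_mul (tame_cos n p q) (tame_cos n p q)))) => u t.
by rewrite /= sin2cos2 mulN1r expr2.
Qed.

Lemma tame_mixed nx ny n px qx py qy a b :
  tame (fun u => mixed nx ny n (px + u * qx) (py + u * qy) a b).
Proof.
apply: tame_ext (tame_add
  (tame_mul (tame_sin2 (nx * ny) (nx%:R * py) (nx%:R * qy))
    (tame_cos n ((b + n%:R * px) / nx%:R) (n%:R * qx / nx%:R)))
  (tame_mul (tame_sin2 (nx * ny) (ny%:R * px) (ny%:R * qx))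
    (tame_cos n ((a + n%:R * py) / ny%:R) (n%:R * qy / ny%:R)))) => u t.
rewrite /mixed /wave; congr (sin _ ^+ 2 * cos _ + sin _ ^+ 2 * cos _); ring.
Qed.

Lemma tame_mixed_cst nx ny n px py a b : tame (fun _ => mixed nx ny n px py a b).
Proof.
by apply: tame_ext (tame_mixed nx ny n px 0 py 0 a b) => u t; rewrite !mulr0 !addr0.
Qed.

Lemma crossing_coprime_neq0 (m n r : nat) p sg tau : (0 < n)%N -> coprime n r ->
  crossing m n p sg tau -> sin (r%:R * tau) != 0.
Proof.
move=> n0 cnr [t0 _ nt]; apply: contra t0 => /eqP rt.
by apply/eqP; exact: sin_coprime_eq0 cnr n0 nt rt.
Qed.

(** Replacing [n] by [n'] changes both angles in the gap by integral multiples of [2 * pi], so the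
    two gaps differ only in the sine handled by [same_phase_sin]. The integer [e] may be negative,
    so frequencies can be lowered as well as raised. *)
Lemma mixed_wave_crossing nx ny n n' (e : int) px py pz a b sg tau :
  (0 < nx)%N -> (0 < ny)%N -> coprime ny n ->
  n'%:R = n%:R + e%:~R * (2 * nx%:R * ny%:R) :> R ->
  sin (ny%:R * px - nx%:R * py) != 0 ->
  same_phase nx b (nx%:R * pz - n'%:R * px) -> crossing nx ny px sg tau ->
  0 < gap (mixed nx ny n px py a b) sg tau * gap (wave n' pz) sg tau.
Proof.
move=> nx0 ny0 cyn nE gc ph cr.
have B0 := crossing_coprime_neq0 ny0 cyn cr.
case: cr => _ /sin_eq0P[k h] nt.
rewrite (mixed_gap_crossing _ _ _ _ nx0 h nt) (wave_gap_crossing _ _ _ nx0 h).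
have nR0 : nx%:R != 0 :> R by rewrite pnatr_eq0 -lt0n.
have A := same_phase_sin (n%:Z * k) nx0 ph.
set b' := _ - _ in A *.
have -> : sin (((n'%:Z * k)%:~R * pi + b') / nx%:R) =
    sin (((n%:Z * k)%:~R * pi + b') / nx%:R).
  rewrite -[RHS](sin_add2pi (e * ny%:Z * k)); congr sin.
  by rewrite !rmorphM /= -!pmulrn nE; field; exact: nR0.
have -> : sin (n'%:R * tau) = sin (n%:R * tau).
  have /sin_eq0P[l hl] := nt.
  rewrite -[RHS](sin_add2pi (e * nx%:Z * l)); congr sin.
  rewrite !rmorphM /= -!pmulrn nE mulrDl; congr (_ + _).
  have -> : e%:~R * nx%:R * l%:~R * (2 * pi) = e%:~R * nx%:R * 2 * (l%:~R * pi) :> R by ring.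
  by rewrite -hl; ring.
set S := sin _ in gc *; set A1 := sin _ in A *; set A2 := sin _ in A *.
set B := sin _ in B0 *.
have -> : S ^+ 2 * (- 2 * (A1 * B)) * (- 2 * (A2 * B)) =
  4 * (S ^+ 2 * B ^+ 2) * (A1 * A2) by ring.
by rewrite mulr_gt0// mulr_gt0// mulr_gt0// exprn_even_gt0.
Qed.

Definition mixed_curve nx ny n px py a b t : R * R * R :=
  (wave nx px t, wave ny py t, mixed nx ny n px py a b t).

(** Both directions come from [height_isotopic] with the heights exchanged, in place of a symmetry
    property of isotopies. *)
Lemma liss_mixed_isotopic nx ny n n' (e : int) px py pz a b :
  (0 < nx)%N -> (0 < ny)%N -> coprime nx ny -> coprime ny n -> coprime nx n ->
  n'%:R = n%:R + e%:~R * (2 * nx%:R * ny%:R) :> R ->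
  sin (ny%:R * px - nx%:R * py) != 0 ->
  same_phase nx b (nx%:R * pz - n'%:R * px) ->
  same_phase ny a (ny%:R * pz - n'%:R * py) ->
  strongly_isotopic (loop_of (liss nx ny n' px py pz))
                    (loop_of (mixed_curve nx ny n px py a b)) /\
  strongly_isotopic (loop_of (mixed_curve nx ny n px py a b))
                    (loop_of (liss nx ny n' px py pz)).
Proof.
move=> nx0 ny0 cxy cyn cxn nE gc phb pha.
have gz sg tau : crossing nx ny px sg tau \/ crossing ny nx py sg tau ->
    0 < gap (mixed nx ny n px py a b) sg tau * gap (wave n' pz) sg tau.
  case=> cr; first exact: mixed_wave_crossing nE gc phb cr.
  have nE' : n'%:R = n%:R + e%:~R * (2 * ny%:R * nx%:R) :> R by rewrite nE; ring.
  have gc' : sin (nx%:R * py - ny%:R * px) != 0 by rewrite -opprB sinN oppr_eq0.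
  by rewrite mixedC; exact: mixed_wave_crossing nE' gc' pha cr.
split; apply: height_isotopic => //.
- exact: tame_wave.
- exact: tame_mixed_cst.
- by move=> sg tau; rewrite mulrC; exact: gz.
- exact: tame_mixed_cst.
- exact: tame_wave.
Qed.

Definition in_strip (m : int) (x : R) : Prop := m%:~R * pi < x < (m%:~R + 1) * pi.

Lemma same_phase_shift n (m i : int) a b : in_strip m a ->
  in_strip m (b + i%:~R * (2 * n%:R * pi)) -> same_phase n a b.
Proof. by move=> /andP[? ?] /andP[? ?]; exists m, i. Qed.

Lemma in_strip_sin (m : int) (x : R) : in_strip m x -> sin x != 0.
Proof.
move=> sx; have ph : same_phase 1 x x.
  by apply: (@same_phase_shift _ m 0) => //; rewrite mul0r addr0.
have := same_phase_sin 0 (ltn0Sn 0) ph.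
by rewrite mul0r add0r divr1; case: eqP => // ->; rewrite mul0r ltxx.
Qed.

Lemma sin_in_strip (x : R) : sin x != 0 -> in_strip (Num.floor (x / pi)) x.
Proof.
move=> sx; have pi0 := pi_gt0 R.
have /andP[] := floor_itv (x / pi).
rewrite (ler_pdivlMr _ _ pi0) => h1; rewrite (ltr_pdivrMr _ _ pi0) rmorphD /= => h2.
apply/andP; split => //; rewrite lt_neqAle h1 andbT.
by apply: contra sx => /eqP <-; rewrite sin_intpi.
Qed.

(** On a Lissajous curve [a], [b], [c] are tied by a linear relation. The mixed height frees [a] and
    [b] from [px] and [py], so the projection can move while the signs at the crossings stay
    fixed. *)
Lemma liss_isotopic nx ny n n' (e mc : int) px py pz px' py' pz' :
  (0 < nx)%N -> (0 < ny)%N -> coprime nx ny -> coprime ny n -> coprime nx n ->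
  n'%:R = n%:R + e%:~R * (2 * nx%:R * ny%:R) :> R ->
  in_strip mc (ny%:R * px - nx%:R * py) ->
  in_strip mc (ny%:R * px' - nx%:R * py') ->
  same_phase nx (nx%:R * pz - n%:R * px) (nx%:R * pz' - n'%:R * px') ->
  same_phase ny (ny%:R * pz - n%:R * py) (ny%:R * pz' - n'%:R * py') ->
  strongly_isotopic (loop_of (liss nx ny n px py pz))
                    (loop_of (liss nx ny n' px' py' pz')).
Proof.
move=> nx0 ny0 cxy cyn cxn nE sc sc' phb pha.
set b := nx%:R * pz - _ in phb *; set a := ny%:R * pz - _ in pha *.
have refl (m : nat) (x y : R) : same_phase m x y -> same_phase m x x.
  by move=> [k [i [h1 h2 _ _]]]; exists k, 0; rewrite mul0r addr0.
have n0E : n%:R = n%:R + 0%:~R * (2 * nx%:R * ny%:R) :> R by rewrite mul0r addr0.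
have [s1 _] := liss_mixed_isotopic nx0 ny0 cxy cyn cxn n0E (in_strip_sin sc)
  (refl _ _ _ phb) (refl _ _ _ pha).
have [_ s3] := liss_mixed_isotopic nx0 ny0 cxy cyn cxn nE (in_strip_sin sc') phb pha.
(* Pass to the mixed height at the old phases, move the phases, then pass to the new Lissajous
   height. *)
apply: strongly_isotopic_trans s1 (strongly_isotopic_trans _ s3).
have lin p q : continuous (fun u : R => p + u * q).
  move=> x; apply: cvgD; first exact: cvg_cst.
  by apply: cvgM; [exact: cvg_id|exact: cvg_cst].
(* Strips are convex, so [c] stays in its strip along the segment of phases. *)
have strip u : 0 <= u <= 1 -> in_strip mc
   (ny%:R * (px + u * (px' - px)) - nx%:R * (py + u * (py' - py))).
  move=> /andP[u0 u1]; move: sc sc' => /andP[h1 h2] /andP[h3 h4].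
  have -> : ny%:R * (px + u * (px' - px)) - nx%:R * (py + u * (py' - py)) =
    (1 - u) * (ny%:R * px - nx%:R * py) + u * (ny%:R * px' - nx%:R * py') by ring.
  set c := _ - _ in h1 h2 *; set c' := _ - _ in h3 h4 *.
  case: (ltgtP u 0) u0 => // [u0' _|-> _]; last first.
    by rewrite subr0 mul1r mul0r addr0; apply/andP.
  have v0 : 0 <= 1 - u by lra.
  have k1 := ler_wpM2l v0 (ltW h1); have k2 := ler_wpM2l v0 (ltW h2).
  have k3 : u * (mc%:~R * pi) < u * c' by rewrite ltr_pM2l.
  have k4 : u * c' < u * ((mc%:~R + 1) * pi) by rewrite ltr_pM2l.
  by apply/andP; split; lra.
have end0 : mixed_curve nx ny n px py a b = (fun t => (wave nx (px + 0 * (px' - px)) t,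
    wave ny (py + 0 * (py' - py)) t,
    mixed nx ny n (px + 0 * (px' - px)) (py + 0 * (py' - py)) a b t)).
  by rewrite !mul0r !addr0.
have end1 : mixed_curve nx ny n px' py' a b = (fun t => (wave nx (px + 1 * (px' - px)) t,
    wave ny (py + 1 * (py' - py)) t,
    mixed nx ny n (px + 1 * (px' - px)) (py + 1 * (py' - py)) a b t)).
  by rewrite !mul1r !subrKC.
rewrite end0 end1.
apply: (@moving_isotopic R nx ny (fun u => px + u * (px' - px))
  (fun u => py + u * (py' - py))
  (fun u => mixed nx ny n (px + u * (px' - px)) (py + u * (py' - py)) a b)) => //.
- exact: tame_cos.
- exact: tame_cos.
- exact: tame_mixed.
- by move=> u u01; exact: in_strip_sin (strip u u01).
move=> u sg tau u01.
have gc := in_strip_sin (strip u u01).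
have one (mx my : nat) (qx qy a' b' : R) : (0 < mx)%N -> (0 < my)%N -> coprime my n ->
    same_phase mx b' b' ->
    sin (my%:R * qx - mx%:R * qy) != 0 -> crossing mx my qx sg tau ->
    gap (mixed mx my n qx qy a' b') sg tau != 0.
  move=> mx0 my0 cmy ph g cr; have B0 := crossing_coprime_neq0 my0 cmy cr.
  case: cr => _ /sin_eq0P[k h] nt.
  rewrite (mixed_gap_crossing _ _ _ _ mx0 h nt).
  have := same_phase_sin (n%:Z * k) mx0 ph.
  set A := sin _; move=> AA.
  have A0 : A != 0 by apply/eqP => A0; move: AA; rewrite A0 mul0r ltxx.
  have N20 : - 2 != 0 :> R by rewrite oppr_eq0 pnatr_eq0.
  by rewrite !mulf_neq0 ?expf_neq0.
case=> cr; first exact: one (refl _ _ _ phb) gc cr.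
rewrite mixedC; apply: one (refl _ _ _ pha) _ cr => //.
by rewrite -opprB sinN oppr_eq0.
Qed.

(** Everything is reduced to solving the linear relation for the new frequency with offsets in the
    open unit interval. The integer [i] is free since the floor of [a / pi] matters only modulo
    [2 * ny]. *)
Lemma liss_transfer nx ny n n' (e i : int) px py pz (ma mb mc : int) (al be ga : R) :
  (0 < nx)%N -> (0 < ny)%N -> coprime nx ny -> coprime ny n -> coprime nx n ->
  n'%:R = n%:R + e%:~R * (2 * nx%:R * ny%:R) :> R ->
  in_strip ma (ny%:R * pz - n%:R * py) ->
  in_strip mb (nx%:R * pz - n%:R * px) ->
  in_strip mc (ny%:R * px - nx%:R * py) ->
  0 < al < 1 -> 0 < be < 1 -> 0 < ga < 1 ->
  nx%:R * (ma%:~R + 2 * ny%:R * i%:~R + al) - ny%:R * (mb%:~R + be) =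
    n'%:R * (mc%:~R + ga) ->
  exists px' py' pz', generic nx ny n' px' py' pz' /\
    strongly_isotopic (loop_of (liss nx ny n px py pz))
                      (loop_of (liss nx ny n' px' py' pz')).
Proof.
move=> nx0 ny0 cxy cyn cxn nE sa sb sc al01 be01 ga01 E.
have nyR0 : ny%:R != 0 :> R by rewrite pnatr_eq0 -lt0n.
have pi0 := pi_gt0 R.
have strip (m : int) (x : R) : 0 < x < 1 -> in_strip m ((m%:~R + x) * pi).
  by move=> /andP[x0 x1]; apply/andP; rewrite !ltr_pM2r//; split; lra.
(* With [py' = 0], the new [c] and [a] are [ny * px'] and [ny * pz']; the relation then gives the
   new [b]. *)
pose px' := (mc%:~R + ga) * pi / ny%:R.
pose pz' := (ma%:~R + 2 * ny%:R * i%:~R + al) * pi / ny%:R.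
have aE : ny%:R * pz' - n'%:R * 0 = (ma%:~R + 2 * ny%:R * i%:~R + al) * pi.
  by rewrite /pz'; field; exact: nyR0.
have cE : ny%:R * px' - nx%:R * 0 = (mc%:~R + ga) * pi.
  by rewrite /px'; field; exact: nyR0.
have bE : nx%:R * pz' - n'%:R * px' = (mb%:~R + be) * pi.
  have -> : nx%:R * pz' - n'%:R * px' =
    (nx%:R * (ma%:~R + 2 * ny%:R * i%:~R + al) - n'%:R * (mc%:~R + ga)) * pi / ny%:R.
    by rewrite /pz' /px'; field; exact: nyR0.
  by rewrite -E; field; exact: nyR0.
have sa' : in_strip ma (ny%:R * pz' - n'%:R * 0 + (- i)%:~R * (2 * ny%:R * pi)).
  rewrite aE (_ : _ + _ = (ma%:~R + al) * pi); first exact: strip.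
  by rewrite rmorphN /=; ring.
have sb' : in_strip mb (nx%:R * pz' - n'%:R * px') by rewrite bE; exact: strip.
have sc' : in_strip mc (ny%:R * px' - nx%:R * 0) by rewrite cE; exact: strip.
exists px', 0, pz'; split.
  split; [|exact: in_strip_sin sb'|exact: in_strip_sin sc'].
  have := in_strip_sin sa'.
  have -> : (- i)%:~R * (2 * ny%:R * pi) = (- i * ny%:Z)%:~R * (2 * pi) :> R.
    by rewrite [in RHS]rmorphM /= -pmulrn; ring.
  by rewrite sin_add2pi.
apply: (liss_isotopic nx0 ny0 cxy cyn cxn nE sc sc').
  by apply: (@same_phase_shift _ mb 0) => //; rewrite mul0r addr0.
exact: same_phase_shift sa sa'.
Qed.

Lemma strip_offset (m : int) (x : R) : in_strip m x -> exists2 r : R, 0 < r < 1 & x = (m%:~R + r) * pi.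
Proof.
move=> /andP[h1 h2]; have pi0 := pi_gt0 R.
exists (x / pi - m%:~R); last by rewrite addrC subrK divfK// lt0r_neq0.
apply/andP; split; first by rewrite subr_gt0 (ltr_pdivlMr _ _ pi0).
by rewrite ltrBlDl (ltr_pdivrMr _ _ pi0).
Qed.

(** The offsets of [a] and [b] are kept and that of [c] is scaled by the ratio of the old frequency
    to the new, which is below 1. The extra integral term [2 * nx * ny * mc] is balanced by raising
    the floor of [a / pi] by [2 * ny * mc]. *)
Lemma liss_raise_frequency nx ny nz px py pz :
  (0 < nx)%N -> (0 < ny)%N -> (0 < nz)%N ->
  coprime nx ny -> coprime ny nz -> coprime nx nz ->
  generic nx ny nz px py pz ->
  exists px' py' pz', generic nx ny (nz + 2 * nx * ny) px' py' pz' /\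
    strongly_isotopic (loop_of (liss nx ny nz px py pz))
                      (loop_of (liss nx ny (nz + 2 * nx * ny) px' py' pz')).
Proof.
move=> nx0 ny0 nz0 cxy cyz cxz [/sin_in_strip sa /sin_in_strip sb /sin_in_strip sc].
have NE : (nz + 2 * nx * ny)%:R = nz%:R + 1%:~R * (2 * nx%:R * ny%:R) :> R.
  by rewrite natrD !natrM mul1r.
set ma := Num.floor _ in sa; set mb := Num.floor _ in sb; set mc := Num.floor _ in sc.
have [al al01 aE] := strip_offset sa; have [be be01 bE] := strip_offset sb.
have [ga /andP[ga0 ga1] cE] := strip_offset sc.
have nzR : 0 < nz%:R :> R by rewrite ltr0n.
have nxy : 0 < 2 * nx%:R * ny%:R :> R by rewrite !mulr_gt0// ltr0n.
have N0 : 0 < (nz + 2 * nx * ny)%:R :> R by rewrite ltr0n addn_gt0 nz0.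
apply: (@liss_transfer _ _ _ _ 1 mc _ _ _ ma mb mc al be
  (nz%:R * ga / (nz + 2 * nx * ny)%:R)) => //.
  rewrite divr_gt0 ?mulr_gt0//= ltr_pdivrMr// mul1r NE mul1r.
  have : nz%:R * ga < nz%:R by rewrite gtr_pMr.
  by lra.
have rel : nx%:R * (ny%:R * pz - nz%:R * py) - ny%:R * (nx%:R * pz - nz%:R * px) =
  nz%:R * (ny%:R * px - nx%:R * py) by ring.
rewrite aE bE cE in rel.
have pi0 : pi != 0 :> R by rewrite lt0r_neq0// pi_gt0.
have {}rel : nx%:R * (ma%:~R + al) - ny%:R * (mb%:~R + be) = nz%:R * (mc%:~R + ga).
  by apply: (mulIf pi0); rewrite mulrBl -!mulrA.
have gE : (nz + 2 * nx * ny)%:R * (nz%:R * ga / (nz + 2 * nx * ny)%:R) = nz%:R * ga.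
  by rewrite mulrC divfK// lt0r_neq0.
rewrite (mulrDr (nz + 2 * nx * ny)%:R) gE NE mul1r.
have -> : nx%:R * (ma%:~R + 2 * ny%:R * mc%:~R + al) - ny%:R * (mb%:~R + be) =
  nx%:R * (ma%:~R + al) - ny%:R * (mb%:~R + be) + 2 * nx%:R * ny%:R * mc%:~R by ring.
by rewrite rel; ring.
Qed.

(** The integer defect [T'] of the relation can be changed by multiples of [P] through the floor of
    [a / pi]. The hypothesis on [nz] makes the solvable range contain a full set of residues modulo
    [P]. *)
Lemma liss_lower_frequency nx ny nz px py pz :
  (0 < nx)%N -> (0 < ny)%N -> (0 < nz)%N ->
  coprime nx ny -> coprime ny nz -> coprime nx nz ->
  (2 * nx * ny - ny <= nz)%N ->
  generic nx ny (nz + 2 * nx * ny) px py pz ->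
  exists px' py' pz', generic nx ny nz px' py' pz' /\
    strongly_isotopic (loop_of (liss nx ny (nz + 2 * nx * ny) px py pz))
                      (loop_of (liss nx ny nz px' py' pz')).
Proof.
move=> nx0 ny0 nz0 cxy cyz cxz nz_ge [/sin_in_strip sa /sin_in_strip sb /sin_in_strip sc].
have NE : (nz + 2 * nx * ny)%:R = nz%:R + 2 * nx%:R * ny%:R :> R.
  by rewrite natrD !natrM.
have nE : nz%:R = (nz + 2 * nx * ny)%:R + (-1)%:~R * (2 * nx%:R * ny%:R) :> R.
  by rewrite NE mulN1r addrK.
set ma := Num.floor _ in sa; set mb := Num.floor _ in sb; set mc := Num.floor _ in sc.
pose P : int := (2 * nx * ny)%N%:Z.
pose T' : int := nx%:Z * ma - ny%:Z * mb - (nz + 2 * nx * ny)%N%:Z * mc.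
(* The shift by [nx - 1] places the representative [T] between [1 - nx] and [P - nx]. *)
pose q : int := ((T' + nx%:Z - 1) %/ P)%Z.
pose T : int := T' - P * q.
have P0 : 0 < P by rewrite /P; nia.
have T1 : 1 - nx%:Z <= T.
  have := modz_ge0 (T' + nx%:Z - 1) (lt0r_neq0 P0).
  have := divz_eq (T' + nx%:Z - 1) P; rewrite -/q /T; lia.
have T2 : T <= P - nx%:Z.
  have := ltz_pmod (T' + nx%:Z - 1) P0.
  have := divz_eq (T' + nx%:Z - 1) P; rewrite -/q /T; lia.
have T3 : T < ny%:Z + nz%:Z by move: T2; rewrite /P; lia.
have T1R : 1 - nx%:R <= T%:~R :> R.
  by move: T1; rewrite -(ler_int R) rmorphB /= -!pmulrn.
have T3R : T%:~R < ny%:R + nz%:R :> R.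
  have <- : (ny%:Z + nz%:Z)%:~R = ny%:R + nz%:R :> R by rewrite rmorphD /= -!pmulrn.
  by rewrite ltr_int.
have TE : T%:~R = nx%:R * ma%:~R - ny%:R * mb%:~R - (nz%:R + 2 * nx%:R * ny%:R) * mc%:~R
    - 2 * nx%:R * ny%:R * q%:~R :> R.
  by rewrite /T /T' /P !rmorphB !rmorphM /= -!pmulrn natrD !natrM; ring.
have nxR : 0 < nx%:R :> R by rewrite ltr0n.
have nyR : 0 < ny%:R :> R by rewrite ltr0n.
have nzR : 0 < nz%:R :> R by rewrite ltr0n.
have D0 : 0 < nx%:R + ny%:R + nz%:R :> R by lra.
(* The offsets are sought on the diagonal from (0, 1, 1) to (1, 0, 0) of the cube, along which
   [nx * al - ny * be - nz * ga] runs from [- (ny + nz)] to [nx]; [la] is where it equals [- T]. *)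
pose la : R := (ny%:R + nz%:R - T%:~R) / (nx%:R + ny%:R + nz%:R).
have /andP[la0 la1] : 0 < la < 1.
  by rewrite divr_gt0 ?ltr_pdivrMr//=; lra.
have laE : la * (nx%:R + ny%:R + nz%:R) = ny%:R + nz%:R - T%:~R.
  by rewrite divfK// lt0r_neq0.
have cyN : coprime ny (nz + 2 * nx * ny) by rewrite /coprime addnC gcdnMDl.
have cxN : coprime nx (nz + 2 * nx * ny) by rewrite /coprime addnC mulnAC gcdnMDl.
(* Here [q] accounts for the reduction modulo [P] and [mc] for the change of frequency in the term
   with [c]. *)
apply: (@liss_transfer _ _ _ _ (-1) (- (q + mc)) _ _ _ ma mb mc la (1 - la) (1 - la)) => //.
- by rewrite la0.
- by lra.
- by lra.
- rewrite rmorphN rmorphD /=; move: TE laE; lra.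
Qed.

End FrequencyShift.

(* Inclusions between the sets of Lissajous knots *)
Local Close Scope ring_scope.

Lemma Lset_subset (nx ny n n' : nat) :
  (0 < nx)%N -> (0 < ny)%N -> (0 < n)%N -> (0 < n')%N ->
  coprime nx ny -> coprime ny n' -> coprime nx n' ->
  (forall px py pz : (Rdefinitions.R : realType), generic nx ny n px py pz ->
    exists px' py' pz', generic nx ny n' px' py' pz' /\
      strongly_isotopic (loop_of (liss nx ny n px py pz))
                        (loop_of (liss nx ny n' px' py' pz'))) ->
  Lset nx ny n `<=` Lset nx ny n'.
Proof.
move=> nx0 ny0 n0 n'0 cxy cyn cxn transfer A [px [py [pz [emb eqv]]]].
(* [embedded] and [lissajous] unfold to [injective_loop] and [liss] over these reals, so [emb]
   applies as it stands. *)
have [py1 [pz1 [g1 iso1]]] := @liss_perturb_generic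
  (Rdefinitions.R : realType) nx ny n px py pz nx0 ny0 n0 emb.
have [px2 [py2 [pz2 [g2 iso2]]]] := transfer _ _ _ g1.
exists px2, py2, pz2; split.
  exact: (generic_injective nx0 ny0 n'0 cxy cyn cxn g2).
exact: (knot_equiv_strong_trans eqv (strongly_isotopic_trans iso1 iso2)).
Qed.

Theorem theorem2 (nx ny nz : nat) :
  (0 < nx)%N -> (0 < ny)%N -> (0 < nz)%N ->
  coprime nx ny -> coprime ny nz -> coprime nx nz ->
  Lset nx ny nz `<=` Lset nx ny (nz + 2 * nx * ny) /\
  ((2 * nx * ny - ny <= nz)%N -> Lset nx ny nz = Lset nx ny (nz + 2 * nx * ny)).
Proof.
move=> nx0 ny0 nz0 cxy cyz cxz.
have N0 : (0 < nz + 2 * nx * ny)%N by rewrite addn_gt0 nz0.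
have cyN : coprime ny (nz + 2 * nx * ny) by rewrite /coprime addnC gcdnMDl.
have cxN : coprime nx (nz + 2 * nx * ny) by rewrite /coprime addnC mulnAC gcdnMDl.
have sub : Lset nx ny nz `<=` Lset nx ny (nz + 2 * nx * ny).
  by apply: Lset_subset => // px py pz; exact: liss_raise_frequency.
split=> // nz_ge; apply/seteqP; split=> //.
by apply: Lset_subset => // px py pz; exact: liss_lower_frequency.
Qed.
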